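(* Let $p\in(0,\infty)$, $t\in[p+1,\infty)$ and $h\in((p+1)^{-1},1)$. Consider a conformal iterated function system on $X=[0,1]$ with index set $\{2,3,4,\dots\}$ and limit set $F$ such that: (a) for all integers $i\ge2$ there is $c_i\in(0,(i-1)^{-p}-i^{-p})$ such that $S_i(x)=c_ix+i^{-p}$ for all $x\in[0,1]$; (b) there is $N\in\mathbb{N}$ such that $c_i=p\,i^{-t}$ for all $i\ge N$; (c) $\dim_{\mathrm H}F=h$. Then the following hold. (1) If $t=p+1$ then $$\dim_{\mathrm A}^\theta F=\begin{cases}h+\frac{\theta}{p(1-\theta)}(1-h),&0\le\theta<\frac{p}{1+p},\\ 1,&\frac{p}{1+p}\le\theta\le1.\end{cases}$$ (2) If $p+1<t<p+h^{-1}$ then $$\dim_{\mathrm A}^\theta F=\begin{cases}h+\frac{\theta}{p(1-\theta)}(1-h(t-p)),&0\le\theta\le\frac{(h+hp-1)p}{(1+p)(ht-1)},\\ \frac{1}{(1+p)(1-\theta)},&\frac{(h+hp-1)p}{(1+p)(ht-1)}<\theta<\frac{p}{1+p},\\ 1,&\frac{p}{1+p}\le\theta\le1.\end{cases}$$ (3) If $t\ge p+h^{-1}$ then $$\dim_{\mathrm A}^\theta F=\begin{cases}h,&0\le\theta\le\frac{h+hp-1}{h(1+p)},\\ \frac{1}{(1+p)(1-\theta)},&\frac{h+hp-1}{h(1+p)}<\theta<\frac{p}{1+p},\\ 1,&\frac{p}{1+p}\le\theta\le1.\end{cases}$$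
   Context: Notation: $\mathbb{N}=\{1,2,3,\dots\}$; $B(x,r)$ is the open ball; $N_r(E)$ is the smallest number of balls of radius $r$ needed to cover $E$; $\dim_{\mathrm H}$ and $\overline{\dim}_{\mathrm B}$ are Hausdorff and upper box dimension. A system of similarity contractions $S_i:[0,1]\to[0,1]$, $i\in I=\{2,3,\dots\}$, is a conformal iterated function system (CIFS) if the contraction ratios are bounded above by some $\xi<1$ and the open set condition $S_i((0,1))\subset(0,1)$, $S_i((0,1))\cap S_j((0,1))=\varnothing$ for $i\ne j$ holds, and the maps extend to similarity maps from an open bounded interval $V\supset[0,1]$ into $V$ (the remaining requirements of the general definition of a CIFS, namely the cone condition, conformality with Hölder derivative, and bounded distortion, hold automatically for similarities of $[0,1]$). Its limit set is $F=\bigcup_{w\in I^{\mathbb{N}}}\bigcap_{n\ge1}S_{w_1}\circ\cdots\circ S_{w_n}([0,1])$. Assouad spectrum: for a non-empty bounded set $E$ and $\theta\in(0,1)$, $\dim_{\mathrm A}^\theta E=\inf\{\alpha:\exists C>0\ \forall x\in E\ \forall\,0<R\le1,\ N_{R^{1/\theta}}(B(x,R)\cap E)\le CR^{\alpha(1-1/\theta)}\}$. Conventions at endpoints: $\dim_{\mathrm A}^0E=\overline{\dim}_{\mathrm B}E$ and $\dim_{\mathrm A}^1E=\dim_{\mathrm{qA}}E:=\lim_{\theta\to1^-}\dim_{\mathrm A}^\theta E$ (quasi-Assouad dimension). *)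

(* Defs.v *)
From HB Require Import structures.
From mathcomp Require Import all_boot all_order all_algebra.
From mathcomp Require Import all_classical all_reals all_analysis.

Set Implicit Arguments.
Unset Strict Implicit.
Unset Printing Implicit Defensive.

Import Order.TTheory GRing.Theory Num.Theory.
Import numFieldNormedType.Exports.

Local Open Scope classical_set_scope.
Local Open Scope ring_scope.

Section Dimensions.
Variable R : realType.
Implicit Types (E A : set R) (theta alpha s delta r rho : R).

(* The centres of the balls need not lie in [E]; the value is [+oo] when [E]
   has no finite cover. *)
Definition covering_number r E : \bar R :=
  ereal_inf [set ((size l)%:R)%:E | l in
    [set l : seq R | E `<=` \bigcup_(x in [set` l]) ball x r]].

Definition upper_box_dim E : \bar R :=
  limf_esup (fun r => (lne (covering_number r E) * ((- ln r)^-1)%:E)%E) 0^'+.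

Definition diam A : \bar R :=
  ereal_sup [set `|xy.1 - xy.2|%:E | xy in A `*` A].

(* Empty pieces are skipped: their [diam] is [-oo], and they contribute 0 to
   the sum whatever [s] is (also for [s = 0], where x `^ 0 = 1). *)
Definition hausdorff_content delta s E : \bar R :=
  ereal_inf [set (\sum_(k <oo | U k != set0) diam (U k) `^ s)%E | U in
    [set U : nat -> set R | E `<=` \bigcup_k U k /\
                            forall k, (diam (U k) <= delta%:E)%E]].

Definition hausdorff_measure s E : \bar R :=
  ereal_sup [set hausdorff_content delta s E | delta in [set d : R | 0 < d]].

Definition hausdorff_dim E : \bar R :=
  ereal_inf [set s%:E | s in
    [set s : R | 0 <= s /\ hausdorff_measure s E = 0%E]].

Definition assouad_spectrum_interior theta E : \bar R :=
  ereal_inf [set alpha%:E | alpha in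
    [set alpha : R | exists2 C : R, 0 < C &
       forall x rho, E x -> 0 < rho <= 1 ->
         (covering_number (rho `^ theta^-1) (ball x rho `&` E)
            <= (C * rho `^ (alpha * (1 - theta^-1)))%:E)%E]].

Definition quasi_assouad_dim E : \bar R :=
  lim (assouad_spectrum_interior theta E @[theta --> (1 : R)^'-]).

(* Meaningful for [0 <= theta <= 1]. *)
Definition assouad_spectrum theta E : \bar R :=
  if theta == 0 then upper_box_dim E
  else if theta == 1 then quasi_assouad_dim E
  else assouad_spectrum_interior theta E.

End Dimensions.

Section IteratedFunctionSystems.
Variable R : realType.
Implicit Types (I : set nat) (S : nat -> R -> R) (w : nat -> nat).

Definition similarity_on (D : set R) (r : R) (f : R -> R) : Prop :=
  0 < r /\ forall x y, D x -> D y -> `|f x - f y| = r * `|x - y|.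

(* The maps are given as total functions; only their values on [0, 1] enter
   [similarity_cifs] and [limit_set]. *)
Record similarity_cifs I S : Prop := SimilarityCIFS {
  cifs_self_map : forall i, I i -> S i @` `[0, 1] `<=` `[0, 1];
  cifs_contraction : exists2 xi : R, xi < 1 &
    forall i, I i -> exists2 r, r <= xi & similarity_on `[0, 1] r (S i);
  cifs_open_set : forall i, I i -> S i @` `]0, 1[ `<=` `]0, 1[;
  cifs_disjoint : forall i j, I i -> I j -> i != j ->
    (S i @` `]0, 1[) `&` (S j @` `]0, 1[) = set0;
  cifs_extension : exists a b : R,
    let V : set R := [set` `]a, b[] in
    (`[0, 1] `<=` V) /\
    forall i, I i -> exists r (T : R -> R),
      [/\ similarity_on V r T,
          T @` V `<=` V &
          forall x, 0 <= x <= 1 -> T x = S i x]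
}.

(* S_{w 0} \o ... \o S_{w (n-1)} *)
Fixpoint word_map S w (n : nat) : R -> R :=
  if n is m.+1 then word_map S w m \o S (w m) else id.

Definition limit_set I S : set R :=
  \bigcup_(w in [set w : nat -> nat | forall n, I (w n)])
    \bigcap_(n in [set n : nat | (1 <= n)%N]) (word_map S w n @` `[0, 1]).

End IteratedFunctionSystems.

(* Main.v *)
(* Write f_i for the affine map x |-> c_i x + i^-p, N_r(E) for the covering
   number, and s for an exponent close to h.

   Pressure: if the sum of c_i^u over finitely many i exceeded 1 while the u-th
   Hausdorff measure of F vanished, then in a cover of F with small total weight
   one could descend forever into cylinders that receive less than their share
   of the weight; the limit point would lie in a set of weight 0. Hence
   sum_i c_i^s < 1 for s > h, and N_r(F) <= A r^-s by induction on the scale,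
   once the pieces f_i(F) with i > r^(-1/(1+p)) are covered as an interval.

   Upper bound: an interval of length L is zoomed until it meets two pieces.
   Except for the one with the smallest index, all the pieces it meets have
   length O(L) because of the gap that follows every piece, and summing
   N_r(f_i(F)) = N_(r/c_i)(F) over them gives, for r <= L <= 1, a bound
   C (r^(-1/(1+p)) + r^-s L^min(s, (ts-1)/p)), uniform in the position.

   Lower bound: N_r(F) >= c r^-s for s < h is immediate from the Hausdorff
   measure. Near 0, a ball of radius R contains the pieces of index above
   R^(-1/p); according to theta one counts whole pieces, one point per piece, or
   the interval they fill up to r = R^(1/theta). Copies of F in the cylinders of
   the word 2...2 give the bound h.

   So for 0 < theta < p/(1+p) the spectrum is the maximum of h,
   1/((1+p)(1-theta)) and (h - theta (th-1)/p) / (1-theta). *)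
Require Import Defs.
From HB Require Import structures.
From mathcomp Require Import all_boot all_order all_algebra.
From mathcomp Require Import all_classical all_reals all_analysis.
From mathcomp Require Import ring lra.
Set Implicit Arguments.
Unset Strict Implicit.
Unset Printing Implicit Defensive.
Import Order.TTheory GRing.Theory Num.Theory.
Import numFieldNormedType.Exports.
Local Open Scope classical_set_scope.
Local Open Scope ring_scope.

(** * Real powers: tangent bound, small values, comparison of exponents *)

Section Powers.
Variable R : realType.
Implicit Types a b x y r : R.

Lemma powRDp x a b : 0 < x -> x `^ (a + b) = x `^ a * x `^ b.
Proof. by move=> x0; rewrite powRD// (gt_eqF x0) implybT. Qed.

Lemma powR_ge1 x a : 1 <= x -> 0 <= a -> 1 <= x `^ a.
Proof. by move=> x1 a0; rewrite -(powRr0 x) ler_powR. Qed.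

Lemma powR_le1 x a : 0 < x <= 1 -> 0 <= a -> x `^ a <= 1.
Proof. by move=> x1 a0; rewrite -(powRr0 x) ger_powR. Qed.

Lemma powRN_ge1 x a : 0 < x <= 1 -> 0 <= a -> 1 <= x `^ (- a).
Proof. by move=> x1 a0; rewrite -[leLHS](powRr0 x) ger_powR// oppr_le0. Qed.

Lemma le_powRl x y a : 0 <= x -> x <= y -> 0 <= a -> x `^ a <= y `^ a.
Proof. by move=> x0 xy a0; rewrite ge0_ler_powR// nnegrE// (le_trans x0). Qed.

Lemma le_powRNl x y a : 0 < x -> x <= y -> 0 <= a -> y `^ (- a) <= x `^ (- a).
Proof.
move=> x0 xy a0; rewrite !powRN lef_pV2 ?posrE ?powR_gt0//.
  by rewrite le_powRl// ltW.
exact: lt_le_trans xy.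
Qed.

Lemma powRKV x a : 0 <= x -> a != 0 -> (x `^ a^-1) `^ a = x.
Proof. by move=> x0 a0; rewrite -powRrM mulVf// powRr1. Qed.

Lemma powR_div x y a : 0 <= x -> 0 < y -> (x / y) `^ a = x `^ a * y `^ (- a).
Proof.
move=> x0 y0; rewrite powRM// ?invr_ge0 ?ltW//.
by rewrite -(powR_inv1 (ltW y0)) -powRrM mulN1r.
Qed.

(** Convexity of z |-> z^-p: its graph lies above the tangent at [y]. This controls the steps
    between consecutive left ends i^-p from both sides. *)
Lemma powR_tangent p x y : 0 <= p -> 0 < x -> 0 < y ->
  p * (y - x) * y `^ (- p - 1) <= x `^ (- p) - y `^ (- p).
Proof.
move=> p0 x0 y0; have xy0 : 0 < x / y by rewrite divr_gt0.
(* With z = x / y the claim is 1 + p (1 - z) <= z^-p, which follows from exp v >= 1 + v and ln z <=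
   z - 1. *)
have key : 1 + p * (1 - x / y) <= (x / y) `^ (- p).
  rewrite /powR gt_eqF//; apply: le_trans (expR_ge1Dx _).
  rewrite lerD2l mulNr -mulrN ler_wpM2l//.
  have := @le_ln1Dx R (x / y - 1); rewrite subrKC => /(_ _)/wrap[]; last by lra.
  by rewrite ltrBrDl subrr.
have yp := powR_gt0 (- p) y0.
rewrite powR_div ?(ltW x0)// opprK in key.
have H := ler_wpM2r (ltW yp) key.
rewrite -[leRHS]mulrA -powRDp// subrr powRr0 mulr1 in H.
rewrite powRDp// powR_inv1 ?(ltW y0)//.
apply: le_trans (lerB H (lexx _)).
rewrite le_eqVlt; apply/orP; left; apply/eqP; field.
by rewrite gt_eqF.
Qed.

Lemma powR_small a e : 0 < a -> 0 < e ->
  exists2 r0, 0 < r0 <= 1 & forall r, 0 < r <= r0 -> r `^ a <= e.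
Proof.
move=> a0 e0; exists (Num.min 1 (e `^ a^-1)).
  by rewrite lt_min ltr01 powR_gt0//= ge_min lexx.
move=> r /andP[r0]; rewrite le_min => /andP[_ re].
by rewrite -(@powRKV e a) ?(ltW e0) ?gt_eqF// le_powRl ?(ltW r0) ?(ltW a0).
Qed.

(** If [b < a], then r^(a - b) tends to 0 with r and the inequality fails for small r. This is how
    lower covering bounds become bounds of exponents. *)
Lemma powR_exponent_le (r0 c C a b : R) : 0 < r0 -> 0 < c ->
  (forall r, 0 < r <= r0 -> c * r `^ (- a) <= C * r `^ (- b)) -> a <= b.
Proof.
move=> r00 c0 H; rewrite leNgt; apply/negP => ba.
have C0 : 0 < C.
  have := H _ (introT andP (conj r00 (lexx _))).
  have := powR_gt0 (-a) r00; have := powR_gt0 (-b) r00 => rb ra Hr.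
  have : 0 < C * r0 `^ (- b) by apply: lt_le_trans Hr; rewrite mulr_gt0.
  by rewrite pmulr_lgt0.
have ab0 : 0 < a - b by rewrite subr_gt0.
have cC : 0 < c / (2 * C) by rewrite divr_gt0// mulr_gt0.
have [r1 /andP[r10 _] Hr1] := powR_small ab0 cC.
pose r := Num.min r0 r1.
have r_gt0 : 0 < r by rewrite lt_min r00.
have /H : 0 < r <= r0 by rewrite r_gt0 ge_min lexx.
have /Hr1 : 0 < r <= r1 by rewrite r_gt0 ge_min lexx orbT.
have -> : r `^ (- b) = r `^ (- a) * r `^ (a - b).
  by rewrite -powRDp//; congr (_ `^ _); ring.
move=> h2 h1.
have ra := powR_gt0 (-a) r_gt0.
have : C * (r `^ (- a) * r `^ (a - b)) <= C * (r `^ (- a) * (c / (2 * C))).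
  by apply: (ler_wpM2l (ltW C0)); apply: (ler_wpM2l (ltW ra)).
have -> : C * (r `^ (- a) * (c / (2 * C))) = c * r `^ (- a) / 2.
  by field; rewrite gt_eqF.
have : 0 < c * r `^ (- a) by rewrite mulr_gt0.
lra.
Qed.

(** Replaces a real cut-off by an integer index at the cost of a factor 2. *)
Lemma exists_nat_between x : 1 <= x ->
  exists n : nat, [/\ (1 <= n)%N, x <= n%:R & n%:R <= 2 * x].
Proof.
move=> x1; have x0 : 0 <= x by lra.
have /andP[h1 h2] := truncn_itv x0.
exists (Num.truncn x).+1; split => //; first exact: ltW.
by rewrite -natr1; lra.
Qed.

End Powers.

(** * Covers by balls under unions, affine maps and separation *)

Section Covers.
Variable R : realType.
Implicit Types (r n m x : R) (E : set R).

(** The bound [n] is real, so that expressions such as A r^-s serve as bounds without rounding. *)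
Definition coverable r E n : Prop := exists2 l : seq R,
  (size l)%:R <= n & E `<=` \bigcup_(x in [set` l]) ball x r.

Lemma coverable_le {r E n} E' n' :
  coverable r E n -> E' `<=` E -> n <= n' -> coverable r E' n'.
Proof.
move=> [l ln El] EE' nn'; exists l; first exact: le_trans nn'.
exact: subset_trans El.
Qed.

Lemma coverable0 r n : 0 <= n -> coverable r set0 n.
Proof. by exists [::]. Qed.

Lemma coverableU r E E' n n' :
  coverable r E n -> coverable r E' n' -> coverable r (E `|` E') (n + n').
Proof.
move=> [l ln El] [l' ln' El']; exists (l ++ l').
  by rewrite size_cat natrD lerD.
by move=> x [/El|/El'] [y /= yl xy]; exists y => //=; rewrite mem_cat yl ?orbT.
Qed.

Lemma coverable_bigcup r (E : nat -> set R) (u : nat -> R) (a b : nat) :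
  (forall i, (a <= i < b)%N -> coverable r (E i) (u i)) ->
  coverable r (\bigcup_(i in [set i | (a <= i < b)%N]) E i)
    (\sum_(a <= i < b) u i).
Proof.
elim: b => [|b IH] H.
  rewrite big_geq//; apply: coverable_le (coverable0 _ (lexx 0)) _ _ => //.
  by move=> x [i /=]; rewrite ltn0 andbF.
have [ab|ba] := leqP a b; last first.
  rewrite big_geq//; apply: coverable_le (coverable0 _ (lexx 0)) _ _ => //.
  move=> x [i /=] /andP[ai]; rewrite ltnS => ib.
  by have := leq_trans (leq_trans ba ai) ib; rewrite ltnn.
rewrite big_nat_recr//=.
have {}IH : coverable r (\bigcup_(i in [set i | (a <= i < b)%N]) E i)
    (\sum_(a <= i < b) u i).
  by apply: IH => i /andP[ai ib]; apply: H; rewrite ai ltnS ltnW.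
have Hb : coverable r (E b) (u b) by apply: H; rewrite ab ltnSn.
apply: coverable_le (coverableU IH Hb) _ _ => // x [i /=].
rewrite ltnS => /andP[ai]; rewrite leq_eqVlt => /predU1P[->|ib] Ex; first by right.
by left; exists i => //=; rewrite ai.
Qed.

Lemma coverable_itv r (a b : R) : 0 < r -> a <= b ->
  coverable r [set x | a <= x <= b] ((b - a) / r + 1).
Proof.
move=> r0 ab; pose k (y : R) := Num.truncn ((y - a) / r).
have ba : 0 <= (b - a) / r by rewrite divr_ge0 ?subr_ge0// ltW.
exists [seq a + i%:R * r | i <- iota 0 (k b).+1].
  rewrite size_map size_iota -natr1 lerD2r.
  by have /andP[] := truncn_itv ba.
move=> y /= /andP[ay yb].
have ya : 0 <= (y - a) / r by rewrite divr_ge0 ?subr_ge0// ltW.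
have /andP[h1 h2] := truncn_itv ya.
have ky : (k y \in iota 0 (k b).+1)%N.
  rewrite mem_iota add0n ltnS.
  by apply: le_truncn; rewrite // ler_pM2r ?invr_gt0// lerB.
exists (a + (k y)%:R * r); first exact: (map_f (fun i : nat => a + i%:R * r) ky).
rewrite /ball /= ltr_norml.
move: h1 h2; rewrite ler_pdivlMr// ltr_pdivrMr// -natr1 -/(k y) => h1 h2.
apply/andP; split; lra.
Qed.

Lemma coverable_affine k b r E n : 0 < k ->
  coverable r E n -> coverable (k * r) [set k * x + b | x in E] n.
Proof.
move=> k0 [l ln El]; exists [seq k * x + b | x <- l]; first by rewrite size_map.
move=> _ [x /El[y /= yl xy] <-]; exists (k * y + b); first exact: map_f.
move: xy; rewrite /ball /= => xy.
have -> : k * y + b - (k * x + b) = k * (y - x) by ring.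
by rewrite normrM (gtr0_norm k0) ltr_pM2l.
Qed.

Lemma coverable_affineE k b r E n : 0 < k ->
  coverable (k * r) [set k * x + b | x in E] n <-> coverable r E n.
Proof.
move=> k0; split=> [H|]; last exact: coverable_affine.
have k0' : 0 < k^-1 by rewrite invr_gt0.
have := coverable_affine (- (b / k)) k0' H.
rewrite mulKf ?gt_eqF// => /coverable_le; apply => // x Ex.
exists (k * x + b); first by exists x.
by field; rewrite gt_eqF.
Qed.

Lemma covering_number_le r E n :
  coverable r E n -> (covering_number r E <= n%:E)%E.
Proof.
move=> [l ln El]; apply: le_trans (_ : (size l)%:R%:E <= _)%E.
  by apply: ereal_inf_lbound; exists l.
by rewrite lee_fin.
Qed.

(** The factor 2 leaves room above the infimum, so that some cover stays below the bound; exponents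
    are not affected. *)
Lemma covering_number_coverable r E n : 0 < n ->
  (covering_number r E <= n%:E)%E -> coverable r E (2 * n).
Proof.
move=> n0 H; have : (covering_number r E < (2 * n)%:E)%E.
  by apply: le_lt_trans H _; rewrite lte_fin; lra.
by move=> /ereal_inf_lt[_ [l El <-]]; rewrite lte_fin => /ltW ln; exists l.
Qed.

(** No ball of radius [r] meets two of the sets, because they are at distance at least [2 * r], so
    the numbers of balls needed for each of them add up. *)
Lemma separated_cover_size r (u : R) (E : nat -> set R) (a b : nat) (l : seq R) :
  (forall i j x y, (a <= i < b)%N -> (i < j)%N -> (j < b)%N ->
    E i x -> E j y -> 2 * r <= `|x - y|) ->
  (forall i, (a <= i < b)%N -> forall n, coverable r (E i) n -> u <= n) ->
  (forall i, (a <= i < b)%N -> E i `<=` \bigcup_(x in [set` l]) ball x r) ->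
  (b - a)%:R * u <= (size l)%:R.
Proof.
elim: b l => [|b IH] l sep hu El; first by rewrite sub0n mul0r.
have [ab|ba] := leqP a b; last first.
  by move: ba; rewrite -subn_eq0 => /eqP->; rewrite mul0r.
(* [P] selects the balls that meet the last set; these cover it, and the others must cover all the
   earlier sets. *)
pose P x := `[< exists2 y, E b y & ball x r y >].
rewrite subSn// -natr1 mulrDl mul1r -(count_predC P l) natrD [leRHS]addrC.
rewrite -!size_filter lerD//.
  apply: IH.
  - move=> i j x y /andP[ai ib] ij jb; apply: sep => //; last exact: ltnW.
    by rewrite ai ltnS ltnW.
  - by move=> i /andP[ai ib]; apply: hu; rewrite ai ltnS ltnW.
  - move=> i /andP[ai ib] y Ey.
    have aib : (a <= i < b.+1)%N by rewrite ai ltnS ltnW.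
    have [x xl xy] := El i aib y Ey; exists x => //=.
    rewrite mem_filter xl andbT; apply/asboolP => -[z Ez xz].
    have := sep i b y z aib ib (ltnSn b) Ey Ez; apply/negP; rewrite -ltNge.
    move: xy xz; rewrite /ball /= => xy xz.
    have -> : y - z = (x - z) - (x - y) by ring.
    by apply: le_lt_trans (ler_normB _ _) _; lra.
have hb : (a <= b < b.+1)%N by rewrite ab ltnSn.
apply: (hu b hb); exists (seq.filter P l) => // y Ey.
have [x xl xy] := El b hb y Ey; exists x => //=.
by rewrite mem_filter xl andbT; apply/asboolP; exists y.
Qed.

End Covers.

(** * Pieces of a self-similar set accumulating at 0 *)

Section SelfSimilarSet.
Variables (R : realType) (p t : R) (c : nat -> R) (F : set R).
Implicit Types (x y r L a : R) (i m n K : nat).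
Hypothesis p_gt0 : 0 < p.
Hypothesis t_ge : p + 1 <= t.
Hypothesis c_bounds : forall i : nat, (2 <= i)%N ->
  0 < c i < i.-1%:R `^ (- p) - i%:R `^ (- p).
Hypothesis F01 : forall x, F x -> 0 <= x <= 1.

Local Notation q i := (i%:R `^ (- p)).
Definition piece i : set R := [set c i * y + q i | y in F].

Hypothesis F_pieces : forall x, F x -> exists2 i, (2 <= i)%N & piece i x.
Hypothesis pieces_F : forall i, (2 <= i)%N -> piece i `<=` F.

Lemma leq_pred_lt (i j : nat) : (i < j)%N -> (i <= j.-1)%N.
Proof. by case: j. Qed.

Lemma left_end_anti (i j : nat) : (0 < i)%N -> (i <= j)%N -> q j <= q i.
Proof. by move=> i0 ij; rewrite le_powRNl ?ltr0n ?ler_nat// ltW. Qed.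

Lemma left_end_gt0 (i : nat) : (0 < i)%N -> 0 < q i.
Proof. by move=> i0; rewrite powR_gt0// ltr0n. Qed.

Lemma ratio_gt0 (i : nat) : (2 <= i)%N -> 0 < c i.
Proof. by move=> /c_bounds/andP[]. Qed.

(** Distance from 1 to the right end of [[q 2, q 2 + c 2]], the rightmost first-level interval. *)
Definition end_gap : R := 1 - 2%:R `^ (- p) - c 2.

Lemma end_gap_gt0 : 0 < end_gap.
Proof. by have /andP[_] := c_bounds (leqnn 2); rewrite /= powR1 /end_gap; lra. Qed.

Lemma piece_itv (i : nat) x : (2 <= i)%N -> piece i x -> q i <= x <= q i + c i.
Proof.
move=> i2 [y /F01/andP[y0 y1] <-]; have := ratio_gt0 i2 => c0.
by rewrite addrC lerDl mulr_ge0 ?(ltW c0)//= lerD2l ler_piMr ?(ltW c0).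
Qed.

Lemma piece_lt (i : nat) x : (2 <= i)%N -> piece i x -> x < q i.-1.
Proof.
by move=> i2 /(piece_itv i2)/andP[_]; have /andP[_] := c_bounds i2; lra.
Qed.

Lemma F_le x : F x -> x <= 1 - end_gap.
Proof.
move=> /F_pieces[i]; rewrite leq_eqVlt => /predU1P[<-|i3 xi].
  by move=> /(piece_itv (leqnn 2))/andP[_]; rewrite /end_gap; lra.
have i2 := ltnW i3; have := piece_lt i2 xi.
have : q i.-1 <= q 2 by apply: left_end_anti => //; exact: leq_pred_lt.
by have := ratio_gt0 (leqnn 2); rewrite /end_gap; lra.
Qed.

(* [F] misses an interval of length [end_gap] at the right end of [[0, 1]],
   hence every piece is followed by a gap comparable to its own length. *)
Lemma piece_gap (a b : nat) x y : (2 <= a)%N -> (a < b)%N ->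
  piece a x -> piece b y -> end_gap * c b <= x - y.
Proof.
move=> a2 ab xa [z Fz <-]; have /andP[ax _] := piece_itv a2 xa.
have b2 : (2 <= b)%N by exact: leq_trans a2 (ltnW ab).
have : q b.-1 <= q a.
  by apply: left_end_anti; [exact: ltnW|exact: leq_pred_lt].
have := ler_wpM2l (ltW (ratio_gt0 b2)) (F_le Fz).
by have /andP[_] := c_bounds b2; lra.
Qed.

(** For [i = 2] the interval of length [c i] lies to the right of [q 2 > 0]; for larger [i] it lies
    to the left of [q 2 < 1]. *)
Lemma contraction_bound : exists2 xi : R, 0 < xi < 1 &
  forall i, (2 <= i)%N -> c i <= xi.
Proof.
have q2 := left_end_gt0 (ltn0Sn 1).
have q21 : q 2 < 1.
  by have := end_gap_gt0; have := ratio_gt0 (leqnn 2); rewrite /end_gap; lra.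
exists (Num.max (1 - q 2) (q 2)).
  by rewrite lt_max q2 orbT gt_max q21 andbT gtrBl.
move=> i; rewrite leq_eqVlt => /predU1P[<-|i3].
  have /andP[_] := c_bounds (leqnn 2); rewrite /= powR1 => /ltW h.
  by rewrite le_max h.
have i2 := ltnW i3; have /andP[_] := c_bounds i2.
have : q i.-1 <= q 2 by apply: left_end_anti => //; exact: leq_pred_lt.
have := left_end_gt0 (ltnW i2) => h1 h2 h3.
by rewrite le_max; apply/orP; right; lra.
Qed.

(* Neighbouring pieces of index beyond [g r] are at distance less than about
   [r], so that there balls of radius [r] cover best as on an interval. *)
Local Notation g r := (r `^ (- (1 + p)^-1)).

Lemma p1_gt0 : 0 < 1 + p.
Proof. exact: addr_gt0. Qed.

Lemma ip1_gt0 : 0 < (1 + p)^-1.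
Proof. by rewrite invr_gt0 p1_gt0. Qed.

Lemma crossover_ge1 r : 0 < r <= 1 -> 1 <= g r.
Proof. by move=> r01; rewrite powRN_ge1// ltW// ip1_gt0. Qed.

Lemma crossoverXNp r : 0 < r -> g r `^ (- p) / r = g r.
Proof.
move=> r0; rewrite -powRrM -(powR_inv1 (ltW r0)) -powRDp//.
by congr (_ `^ _); field; rewrite gt_eqF// p1_gt0.
Qed.

(** [maxn 2 m] keeps the indices within the alphabet, so that [far_pieces 2] is all of [F]. *)
Definition far_pieces (m : nat) : set R :=
  \bigcup_(i in [set i | (maxn 2 m <= i)%N]) piece i.

Lemma far_pieces_le (K : nat) x : (0 < K)%N -> far_pieces K.+1 x -> 0 <= x <= q K.
Proof.
move=> K0 [i /=]; rewrite geq_max => /andP[i2 Ki] xi.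
have /andP[h _] := piece_itv i2 xi; have := left_end_gt0 (ltnW i2).
have := piece_lt i2 xi; have : q i.-1 <= q K.
  by apply: left_end_anti => //; exact: leq_pred_lt.
lra.
Qed.

(** These pieces lie in [[0, q K]], and beyond the crossover this interval has length at most
    [r * g r]. *)
Lemma coverable_far (K : nat) r : 0 < r <= 1 -> g r <= K%:R ->
  coverable r (far_pieces K.+1) (2 * g r).
Proof.
move=> /[dup] r01 /andP[r0 r1] gK; have g1 := crossover_ge1 r01.
have K0 : (0 < K)%N by rewrite -(ltr_nat R) (lt_le_trans _ gK)// (lt_le_trans _ g1).
apply: coverable_le (coverable_itv r0 (ltW (left_end_gt0 K0))) _ _.
  by move=> x /far_pieces_le; exact.
suff : (q K - 0) / r <= g r by lra.
rewrite subr0 -[leRHS]crossoverXNp// ler_pM2r ?invr_gt0//.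
by rewrite le_powRNl ?(ltW p_gt0)// (lt_le_trans _ g1).
Qed.

Lemma far_pieces_split (m n : nat) :
  far_pieces m `<=`
    \bigcup_(i in [set i | (maxn 2 m <= i < n.+1)%N]) piece i `|` far_pieces n.+1.
Proof.
move=> x [i /= mi xi]; have [ni|ni] := leqP n.+1 i; last by left; exists i => //=; rewrite mi.
by right; exists i => //=; move: mi; rewrite !geq_max ni andbT => /andP[].
Qed.

Lemma F_far : F = far_pieces 2.
Proof.
apply/seteqP; split=> x; first by move=> /F_pieces[i i2 xi]; exists i => //=; rewrite maxnn.
by move=> [i /=]; rewrite maxnn => /pieces_F; exact.
Qed.

Lemma coverable_one r : 1 <= r -> coverable r F 1.
Proof.
move=> r1; exists [:: 2^-1] => // x /F01 x01; exists 2^-1 => //=.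
  by rewrite mem_seq1.
by rewrite /ball /= ltr_norml; lra.
Qed.

Lemma coverable_piece i r (n : R) : (2 <= i)%N -> coverable (r / c i) F n ->
  coverable r (piece i) n.
Proof.
move=> i2 /(coverable_affine (q i) (ratio_gt0 i2)).
by rewrite mulrC divfK// gt_eqF// ratio_gt0.
Qed.

Lemma div_powR s x y : 0 < x -> 0 < y -> (x / y) `^ (- s) = y `^ s * x `^ (- s).
Proof. by move=> x0 y0; rewrite powR_div ?(ltW x0)// opprK mulrC. Qed.

(** * Box counting for the whole set when the pressure sum stays below 1 *)

Section Box.
Variables s k : R.
Hypothesis s_ge : (1 + p)^-1 <= s.
Hypothesis k_lt1 : k < 1.
Hypothesis pressure : forall n, \sum_(2 <= i < n) c i `^ s <= k.

(** Solution of A k + 4 = A: each step of the induction on the scale loses four times r^-s, two for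
    the pieces up to the crossover and two for the interval beyond it. *)
Let A := 4 / (1 - k).

Lemma box_constant_ge1 : 1 <= A.
Proof.
have k1 := k_lt1; have := pressure 2; rewrite big_geq// => k0.
by rewrite /A ler_pdivlMr; lra.
Qed.

Lemma crossover_le r : 0 < r <= 1 -> g r <= r `^ (- s).
Proof. by move=> r01; rewrite ger_powR// lerN2. Qed.

(** At scale [r] the piece of index [i] is [F] at scale [r / c i], which is at least [r0] since
    [c i <= xi]; the pieces beyond the crossover are covered as an interval. *)
Lemma box_step (r0 r xi : R) :
  (forall r', 0 < r' <= 1 -> r0 <= r' -> coverable r' F (A * r' `^ (- s))) ->
  0 < xi -> (forall i, (2 <= i)%N -> c i <= xi) ->
  0 <= r0 -> 0 < r <= 1 -> r0 * xi <= r ->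
  coverable r F (A * r `^ (- s)).
Proof.
move=> IH xi0 cxi r00 /[dup] r01 /andP[r_gt0 r1] r0r.
have [K [K1 gK Kg]] := exists_nat_between (crossover_ge1 r01).
have A1 := box_constant_ge1; have k1 := k_lt1.
(* The summand 1 pays for a piece no longer than [r]. *)
have Hp i : (2 <= i < K.+1)%N ->
    coverable r (piece i) (1 + A * (c i `^ s * r `^ (- s))).
  move=> /andP[i2 _]; have ci := ratio_gt0 i2; apply: coverable_piece => //.
  have h0 : 0 <= c i `^ s * r `^ (- s) by rewrite mulr_ge0 ?powR_ge0.
  have [cr|rc] := leP (c i) r.
    apply: coverable_le (coverable_one _) _ _ => //.
      by rewrite ler_pdivlMr// mul1r.
    by rewrite lerDl mulr_ge0//; lra.
  have rci : r0 <= r / c i.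
    rewrite ler_pdivlMr// (le_trans _ r0r)// ler_wpM2l// cxi//.
  have rc01 : 0 < r / c i <= 1 by rewrite divr_gt0//= ler_pdivrMr// mul1r ltW.
  apply: coverable_le (IH _ rc01 rci) _ _ => //.
  by rewrite div_powR//; lra.
rewrite F_far; have := coverableU (coverable_bigcup Hp) (coverable_far r01 gK).
move=> /coverable_le; apply.
  by apply: subset_trans (@far_pieces_split 2 K) _; rewrite maxnn.
rewrite big_split/= -mulr_sumr -mulr_suml sumr_const_nat.
have : (K.+1 - 2)%:R <= 2 * g r :> R.
  by apply: le_trans Kg; rewrite ler_nat subSS leq_subr.
have := ler_wpM2r (powR_ge0 r (- s)) (pressure K.+1).
have := ler_wpM2l (le_trans ler01 A1) (ler_wpM2r (powR_ge0 r (- s)) (pressure K.+1)).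
have := crossover_le r01; rewrite -/(A * _).
have -> : A * r `^ (- s) = A * (k * r `^ (- s)) + 4 * r `^ (- s).
  by rewrite /A; field; rewrite gt_eqF//; lra.
lra.
Qed.

Lemma box_counting_unit r : 0 < r <= 1 -> coverable r F (A * r `^ (- s)).
Proof.
move=> /[dup] r01 /andP[r0 r1].
have [xi /andP[xi0 xi1] cxi] := contraction_bound.
have [n hn] : exists n, xi ^+ n <= r.
  have /cvgr0_norm_le/(_ _ r0) [n _ /(_ n (leqnn n))] :=
    @cvg_expr _ xi ltac:(by rewrite gtr0_norm).
  by rewrite /= ger0_norm ?exprn_ge0 ?(ltW xi0)//; exists n.
elim: n => [|n IH] in r r01 r0 r1 hn *.
  have -> : r = 1 by apply/eqP; rewrite eq_le r1 -(expr0 xi).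
  apply: coverable_le (coverable_one _) _ _ => //.
  by rewrite powR1 mulr1 box_constant_ge1.
apply: (@box_step (xi ^+ n) r xi) => //.
- by move=> r' /andP[r'0 r'1] h; apply: IH => //; rewrite r'0.
- by rewrite exprn_ge0 ?ltW.
- by rewrite -exprSr.
Qed.

(** The summand 1 extends the bound to [r > 1], which occurs when a piece shorter than the radius is
    rescaled to [F]. *)
Lemma box_counting : exists2 A : R, 1 <= A &
  forall r, 0 < r -> coverable r F (A * (1 + r `^ (- s))).
Proof.
exists A; first exact: box_constant_ge1.
move=> r r0; have A1 := box_constant_ge1; have := powR_ge0 r (- s) => rs.
have [r1|r1] := leP r 1.
  apply: coverable_le (box_counting_unit (introT andP (conj r0 r1))) _ _ => //.
  by rewrite ler_wpM2l//; lra.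
apply: coverable_le (coverable_one (ltW r1)) _ _ => //.
have : 0 <= A * r `^ (- s) by rewrite mulr_ge0//; lra.
lra.
Qed.
End Box.

(** * Covering the part of the set in an arbitrary interval *)

Section Upper.
Variables s A Ct : R.
Hypothesis s01 : 0 < s < 1.
Hypothesis ts_gt1 : 1 < t * s.
Hypothesis A_ge1 : 1 <= A.
Hypothesis A_box : forall r, 0 < r -> coverable r F (A * (1 + r `^ (- s))).
Hypothesis Ct_ge1 : 1 <= Ct.
Hypothesis c_le : forall i : nat, (2 <= i)%N -> c i <= Ct * i%:R `^ (- t).

Let s_ge0 : 0 <= s. Proof. by case/andP: s01 => /ltW. Qed.
Let A_ge0 : 0 <= A. Proof. exact: le_trans A_ge1. Qed.

(** Comparison with an integral: the tangent bound gives i^-u <= ((i-1)^(1-u) - i^(1-u)) / (u-1),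
    and these differences telescope. *)
Lemma sum_powR_tail (m n : nat) : (0 < m)%N ->
  \sum_(m <= i < n) i%:R `^ (- (t * s)) <=
    (1 + (t * s - 1)^-1) * m%:R `^ (1 - t * s).
Proof.
move=> m0; set u := t * s; have u0 : 0 < u - 1 by rewrite subr_gt0.
have mR : 1 <= m%:R :> R by rewrite ler1n.
have mu : m%:R `^ (- u) <= m%:R `^ (1 - u) by rewrite ler_powR//; lra.
have hm := powR_ge0 m%:R (1 - u).
have iu : 0 < (u - 1)^-1 by rewrite invr_gt0.
have [mn|nm] := ltnP m n; last first.
  by rewrite big_geq// mulr_ge0// addr_ge0// ltW.
(* The subtracted last term is what lets the induction on [n] close. *)
suff : \sum_(m <= i < n) i%:R `^ (- u) <=
    m%:R `^ (- u) + (m%:R `^ (1 - u) - n.-1%:R `^ (1 - u)) * (u - 1)^-1.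
  move=> /le_trans; apply.
  have : 0 <= n.-1%:R `^ (1 - u) * (u - 1)^-1 by rewrite mulr_ge0 ?powR_ge0// ltW.
  lra.
elim: n mn => // n IH; rewrite ltnS leq_eqVlt => /predU1P[<-|mn].
  by rewrite big_nat1 /= subrr mul0r addr0.
rewrite big_nat_recr ?(ltnW mn)//=; move/(_ mn): IH => IH.
have n0 : (0 < n)%N by case: n mn {IH}.
have n10 : (0 < n.-1)%N by case: n mn {IH n0} => //= n; rewrite ltnS => /(leq_trans m0).
have := @powR_tangent R (u - 1) n.-1%:R n%:R (ltW u0) _ _.
rewrite !ltr0n => /(_ n10 n0).
rewrite -[in n%:R - _](prednK n0) -natr1 addrAC subrr add0r mulr1.
rewrite opprB (_ : 1 - u - 1 = - u); last by ring.
rewrite mulrC -ler_pdivlMr// => h.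
by apply: le_trans (lerD IH h) _; lra.
Qed.

Lemma ratio_powR_le (i : nat) : (2 <= i)%N -> c i `^ s <= Ct `^ s * i%:R `^ (- (t * s)).
Proof.
move=> i2; rewrite -mulNr powRrM -powRM ?powR_ge0//; last exact: le_trans Ct_ge1.
by rewrite le_powRl ?c_le// ltW// ratio_gt0.
Qed.

Lemma coverable_piece_box (i : nat) r : (2 <= i)%N -> 0 < r ->
  coverable r (piece i) (A * (1 + c i `^ s * r `^ (- s))).
Proof.
move=> i2 r0; have c0 := ratio_gt0 i2; apply: coverable_piece => //.
by rewrite -div_powR//; apply: A_box; rewrite divr_gt0.
Qed.

Let Ct_s : 1 <= Ct `^ s. Proof. exact: powR_ge1. Qed.

(** Up to the crossover the pieces are counted one by one, the sum of c_i^s being bounded by a tail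
    of the series of i^(-ts); beyond it they are covered as an interval. *)
Lemma coverable_tail : exists2 C : R, 1 <= C & forall m r, (0 < m)%N ->
  0 < r <= 1 ->
  coverable r (far_pieces m) (C * (g r + m%:R `^ (1 - t * s) * r `^ (- s))).
Proof.
set u := t * s; set D := 1 + (u - 1)^-1.
have u0 : 0 < u - 1 by rewrite subr_gt0.
have D1 : 1 <= D by rewrite lerDl invr_ge0 ltW.
have A1 := A_ge1.
exists (A * Ct `^ s * D + (2 * A + 2)).
  have : 0 <= A * Ct `^ s * D by rewrite !mulr_ge0 ?powR_ge0//; lra.
  lra.
move=> m r m0 /[dup] r01 /andP[r0 r1].
have [K [K1 gK Kg]] := exists_nat_between (crossover_ge1 r01).
have Hp i : (maxn 2 m <= i < K.+1)%N ->
    coverable r (piece i) (A * (1 + Ct `^ s * i%:R `^ (- u) * r `^ (- s))).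
  rewrite geq_max => /andP[/andP[i2 mi] iK].
  apply: coverable_le (coverable_piece_box i2 r0) _ _ => //.
  by rewrite ler_wpM2l// lerD2l ler_wpM2r ?powR_ge0// ratio_powR_le.
have := coverableU (coverable_bigcup Hp) (coverable_far r01 gK).
move=> /coverable_le; apply; first exact: far_pieces_split.
rewrite -mulr_sumr big_split/= sumr_const_nat -mulr_suml -mulr_sumr.
have hK : (K.+1 - maxn 2 m)%:R <= 2 * g r :> R.
  apply: le_trans Kg; rewrite ler_nat leq_subLR.
  by rewrite (leq_trans (_ : _ <= 2 + K)%N)// leq_add2r leq_maxl.
have hm : \sum_(maxn 2 m <= i < K.+1) i%:R `^ (- u) <= D * m%:R `^ (1 - u).
  apply: le_trans (sum_powR_tail _ _) _; first by rewrite leq_max.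
  rewrite -/u -/D ler_wpM2l//; first by lra.
  rewrite -opprB le_powRNl ?ltr0n// ?ler_nat ?leq_maxr//; lra.
have := ler_wpM2l A_ge0 hK.
have rs := powR_ge0 r (- s).
have AC : 0 <= A * Ct `^ s by rewrite mulr_ge0 ?powR_ge0.
have := ler_wpM2r rs (ler_wpM2l AC hm).
have : 0 <= g r by exact: powR_ge0.
have : 0 <= m%:R `^ (1 - u) * r `^ (- s) by rewrite mulr_ge0 ?powR_ge0.
set y := _ * r `^ (- s); set G := g r; set S := \sum_(_ <= _ < _) _.
move=> y0 G0 h1 h2.
have : 0 <= (A * Ct `^ s * D) * G by rewrite !mulr_ge0 ?powR_ge0//; lra.
have : 0 <= A * y by rewrite mulr_ge0.
have E : A * Ct `^ s * (D * m%:R `^ (1 - u)) * r `^ (- s) = A * Ct `^ s * D * y.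
  by rewrite /y; ring.
by rewrite E in h1; lra.
Qed.

Let e := Num.min s ((t * s - 1) / p).

Let e_ge0 : 0 <= e.
Proof. by rewrite le_min s_ge0 divr_ge0 ?(ltW p_gt0)// subr_ge0 ltW. Qed.

(* The minimum in [e] makes the bound non-increasing under the zooms
   [L, r |-> L / k, r / k]; it costs nothing, since [L `^ s * r `^ (- s)] is
   needed anyway for the largest pieces. *)
Definition window_bound L r := g r + L `^ e * r `^ (- s).
Local Notation B := window_bound.

Lemma window_bound_ge0 L r : 0 <= B L r.
Proof. by rewrite addr_ge0 ?mulr_ge0 ?powR_ge0. Qed.

Lemma window_bound_zoom (L r k : R) : 0 < L -> 0 < r -> 0 < k <= 1 ->
  B (L / k) (r / k) <= B L r.
Proof.
move=> L0 r0 /[dup] k01 /andP[k0 k1]; rewrite /B div_powR// lerD//.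
  by rewrite div_powR// ler_piMl ?powR_ge0// powR_le1// ltW ?ip1_gt0.
rewrite powR_div ?(ltW L0)//.
have -> : L `^ e * k `^ (- e) * (k `^ s * r `^ (- s)) =
  k `^ (- e) * k `^ s * (L `^ e * r `^ (- s)) by ring.
rewrite -powRDp// ler_piMl ?mulr_ge0 ?powR_ge0// powR_le1// addrC subr_ge0.
by rewrite ge_min lexx.
Qed.

Lemma powR_le_e L a : 0 < L <= 1 -> s <= a \/ (t * s - 1) / p <= a -> L `^ a <= L `^ e.
Proof. by move=> L1 h; apply: ger_powR => //; rewrite ge_min; case: h => [-> //|->]; exact: orbT. Qed.

(** Since [m] is at least (2L)^(-1/p), the factor m^(1-ts) of the tail bound becomes L^((ts-1)/p) up
    to a constant. *)
Lemma coverable_far_window : exists2 C : R, 1 <= C & forall m L r,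
  (0 < m)%N -> 0 < L <= 1 -> q m <= 2 * L -> 0 < r <= 1 ->
  coverable r (far_pieces m) (C * B L r).
Proof.
have [C C1 HC] := coverable_tail; pose D := 2 `^ ((t * s - 1) / p) : R.
have D1 : 1 <= D.
  by rewrite powR_ge1 ?ler1n// divr_ge0 ?(ltW p_gt0)// subr_ge0 ltW.
exists (C * D); first by have := ler_pM ler01 ler01 C1 D1; rewrite mulr1.
move=> m L r m0 /[dup] L01 /andP[L0 L1] qmL r01.
apply: coverable_le (HC m r m0 r01) _ _ => //.
rewrite -mulrA ler_wpM2l//; first by lra.
rewrite /B mulrDr lerD//.
  by rewrite ler_peMl// powR_ge0.
rewrite mulrA ler_wpM2r ?powR_ge0//.
have -> : m%:R `^ (1 - t * s) = q m `^ ((t * s - 1) / p).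
  by rewrite -powRrM; congr (_ `^ _); field; rewrite gt_eqF.
have h : 0 <= (t * s - 1) / p by rewrite divr_ge0 ?(ltW p_gt0)// subr_ge0 ltW.
apply: le_trans (le_powRl (powR_ge0 _ _) qmL h) _.
rewrite powRM ?(ltW L0)// ler_wpM2l ?powR_ge0//.
by apply: powR_le_e => //; right.
Qed.

Definition window a L : set R := [set x | F x /\ a <= x <= a + L].

(** Such a window meets only pieces with [q i <= L]. It arises by rescaling when a window enters a
    piece from the left. *)
Lemma coverable_window0 : exists2 C : R, 1 <= C & forall a L r,
  a <= 0 -> 0 < L <= 1 -> 0 < r <= 1 -> coverable r (window a L) (C * B L r).
Proof.
have [C C1 HC] := coverable_far_window.
exists C => // a L r a0 /[dup] L01 /andP[L0 L1] r01.
have exm : exists m : nat, (0 < m)%N && (q m <= L).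
  have h1 : 1 <= L `^ (- p^-1) by rewrite powRN_ge1// invr_ge0 ltW.
  have [n [n1 Ln _]] := exists_nat_between h1; exists n; rewrite n1/=.
  apply: le_trans (le_powRNl _ Ln (ltW p_gt0)) _; first by rewrite powR_gt0.
  by rewrite -powRrM mulrNN mulVf ?gt_eqF// powRr1// ltW.
case: (ex_minnP exm) => m /andP[m0 mL] m_min.
have mL2 : q m <= 2 * L by lra.
apply: coverable_le (HC m L r m0 L01 mL2 r01) _ _ => //.
move=> x [/F_pieces[i i2 xi] /andP[_ xL]]; exists i => //=.
rewrite geq_max i2 m_min// (ltnW i2)/=.
by have /andP[+ _] := piece_itv i2 xi; lra.
Qed.

Lemma coverable_small_piece (i : nat) L r : (2 <= i)%N -> 0 < L <= 1 ->
  0 < r <= 1 -> c i <= L -> coverable r (piece i) (A * B L r).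
Proof.
move=> i2 /[dup] L01 /andP[L0 L1] /[dup] r01 /andP[r0 r1] cL.
apply: coverable_le (coverable_piece_box i2 r0) _ _ => //.
rewrite ler_wpM2l// lerD ?crossover_ge1// ler_wpM2r ?powR_ge0//.
apply: le_trans (_ : L `^ s <= _); first by rewrite le_powRl// ltW// ratio_gt0.
by apply: powR_le_e => //; left.
Qed.

Lemma coverable_zoom (i : nat) a L r (n : R) : (2 <= i)%N ->
  coverable (r / c i) (window ((a - q i) / c i) (L / c i)) n ->
  coverable r (window a L `&` piece i) n.
Proof.
move=> i2 /(coverable_affine (q i) (ratio_gt0 i2)).
have c0 := ratio_gt0 i2.
rewrite [c i * _]mulrC divfK ?gt_eqF// => /coverable_le; apply => //.
move=> x [[Fx /andP[ax xL]] [y Fy yx]]; exists y => //; split => //.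
rewrite ler_pdivrMr// -mulrDl ler_pdivlMr//.
by move: ax xL; rewrite -yx => ax xL; apply/andP; split; lra.
Qed.

Definition meets a L (i : nat) := exists2 x, window a L x & piece i x.

Let E := (p + 1) / p.
Let D := 2 `^ E / p.

Let E_gt0 : 0 < E. Proof. by rewrite divr_gt0// addr_gt0. Qed.
Let D_gt0 : 0 < D. Proof. by rewrite divr_gt0// powR_gt0. Qed.

(** The tangent bound at [n] reads p (n - m) n^(-p-1) <= q m - q n <= L, and [q n >= q m / 2] makes
    n^(-p-1) comparable with m^(-p-1). *)
Lemma index_spread m n L : (0 < m)%N -> (m <= n)%N -> 2 * L < q m ->
  q m - q n <= L -> n%:R - m%:R <= D * (L * m%:R `^ (p + 1)).
Proof.
move=> m0 mn qmL qmn; have n0 := leq_trans m0 mn.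
have mR : 0 < m%:R :> R by rewrite ltr0n.
have nR : 0 < n%:R :> R by rewrite ltr0n.
have := powR_tangent (ltW p_gt0) mR nR.
have -> : n%:R `^ (- p - 1) = q n `^ E.
  by rewrite -powRrM; congr (_ `^ _); rewrite /E; field; rewrite gt_eqF.
have qh : q m / 2 <= q n by lra.
have := le_powRl (divr_ge0 (powR_ge0 _ _) (ler0n _ 2)) qh (ltW E_gt0).
rewrite powR_div ?powR_ge0// -powRrM.
have -> : - p * E = - (p + 1) by rewrite /E; field; rewrite gt_eqF.
rewrite (powRN _ (p + 1)) (powRN _ E); set M := m%:R `^ (p + 1); set T := 2%:R `^ E => h1 h2.
have M0 : 0 < M by exact: powR_gt0.
have T0 : 0 < T by rewrite powR_gt0.
have pnm : 0 <= p * (n%:R - m%:R) by rewrite mulr_ge0 ?subr_ge0 ?ler_nat// ltW.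
have h3 : p * (n%:R - m%:R) * (M^-1 * T^-1) <= L.
  by have := ler_wpM2l pnm h1; lra.
have pMT : 0 <= p^-1 * M * T by rewrite !mulr_ge0 ?invr_ge0// ltW.
have := ler_wpM2l pMT h3.
have -> : p^-1 * M * T * (p * (n%:R - m%:R) * (M^-1 * T^-1)) = n%:R - m%:R.
  by field; rewrite !gt_eqF.
by rewrite /D -/T => h; apply: le_trans h _; rewrite le_eqVlt; apply/orP; left; apply/eqP; ring.
Qed.

Lemma meets_q_diff a L i j : (2 <= i)%N -> (2 <= j)%N ->
  meets a L i -> meets a L j -> q i - q j.-1 <= L.
Proof.
move=> i2 j2 [x [_ /andP[ax xL]] xi] [y [_ /andP[ay yL]] yj].
by have := piece_lt j2 yj; have /andP[+ _] := piece_itv i2 xi; lra.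
Qed.

(** The piece of index [j] is followed by a gap of length at least [end_gap * c j], which the window
    crosses in order to reach the piece of index [i]. *)
Lemma meets_c_le a L i j : (2 <= i)%N -> (i < j)%N ->
  meets a L i -> meets a L j -> c j <= L / end_gap.
Proof.
move=> i2 ij [x [_ /andP[ax xL]] xi] [y [_ /andP[ay yL]] yj].
rewrite ler_pdivlMr ?end_gap_gt0// mulrC.
by have := piece_gap i2 ij xi yj; lra.
Qed.

(** A negative power of [m] is at most 1, and L <= L^s. Otherwise m^p <= 1/L turns the product into
    a power of [L] with exponent (ts-1)/p. *)
Lemma few_pieces_power (m : nat) L : (0 < m)%N -> 0 < L <= 1 -> 2 * L < q m ->
  L * m%:R `^ (p + 1 - t * s) <= L `^ e.
Proof.
move=> m0 /[dup] L01 /andP[L0 L1] qmL.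
have mR : 1 <= m%:R :> R by rewrite ler1n.
have [ts|ts] := leP 0 (p + 1 - t * s); last first.
  apply: le_trans (_ : L * 1 <= _).
    by rewrite ler_wpM2l ?(ltW L0)// -[leRHS](powRr0 m%:R) ler_powR// ltW.
  rewrite mulr1 -[leLHS](powRr1 (ltW L0)); apply: powR_le_e => //.
  by left; case/andP: s01 => _ /ltW.
have mp : m%:R `^ p <= L^-1.
  rewrite -[leLHS]invrK lef_pV2 ?posrE ?invr_gt0 ?powR_gt0 ?ltr0n//.
  by rewrite -powRN; lra.
have := le_powRl (powR_ge0 _ _) mp (divr_ge0 ts (ltW p_gt0)).
rewrite -powRrM mulrC divfK ?gt_eqF// -(powR_inv1 (ltW L0)) -powRrM.
move=> /(ler_wpM2l (ltW L0)) /le_trans; apply.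
rewrite -[X in X * _](powRr1 (ltW L0)) -powRDp//; apply: powR_le_e => //; right.
by rewrite le_eqVlt; apply/orP; left; apply/eqP; field; rewrite gt_eqF.
Qed.

(** Away from 0 and before the crossover the window meets at most O(L m^(p+1)) + 2 pieces of index
    at least [m], and their ratios are both O(L) and O(m^-t). *)
Lemma coverable_few_pieces : exists2 C : R, 1 <= C & forall a L r i m,
  (2 <= i)%N -> (i < m)%N -> meets a L i -> meets a L m ->
  0 < L <= 1 -> 2 * L < q m -> 0 < r <= 1 -> m%:R <= 2 * g r ->
  coverable r (window a L `&` far_pieces m) (C * B L r).
Proof.
have k0 := end_gap_gt0.
pose v1 := end_gap `^ (- s); pose v2 := D * Ct `^ s.
have v10 : 0 <= v1 by exact: powR_ge0.
have D0 := D_gt0; have v20 : 0 <= v2 by rewrite mulr_ge0 ?powR_ge0// ltW.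
exists (A * (2 + D + 2 * v1 + v2)).
  have := ler_wpM2l A_ge0 (_ : 1 <= 2 + D + 2 * v1 + v2); have := A_ge1.
  by rewrite mulr1 => ? /(_ ltac:(lra)); lra.
move=> a L r i m i2 im mi mm /[dup] L01 /andP[L0 L1] qmL /[dup] r01 /andP[r0 r1] mg.
have m2 : (2 <= m)%N := leq_trans i2 (ltnW im).
have m0 : (0 < m)%N := ltnW m2.
have mR : 0 < m%:R :> R by rewrite ltr0n.
pose X := D * (L * m%:R `^ (p + 1)).
have X0 : 0 <= X.
  by apply: mulr_ge0 (ltW D0) _; rewrite mulr_ge0 ?powR_ge0// ltW.
have /andP[Xn _] := truncn_itv X0; set n := Num.truncn X in Xn.
(* The first bound serves for two of the pieces, the second for the [n] others: L m^(p+1) times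
   m^(-ts) is what [few_pieces_power] controls. *)
pose v := Num.min ((L / end_gap) `^ s) (Ct `^ s * m%:R `^ (- (t * s))).
have Hp j : (m <= j < m + n.+2)%N ->
    coverable r (window a L `&` piece j) (A * (1 + v * r `^ (- s))).
  move=> /andP[mj _]; have j2 := leq_trans m2 mj.
  have v0 : 0 <= v by rewrite le_min mulr_ge0 ?powR_ge0.
  have [mj'|nmj] := pselect (meets a L j); last first.
    apply: coverable_le (coverable0 r (lexx 0)) _ _.
      by move=> x [wx xj]; apply: nmj; exists x.
    by rewrite mulr_ge0// addr_ge0// mulr_ge0 ?powR_ge0.
  apply: coverable_le (coverable_piece_box j2 r0) _ _ => //.
  rewrite ler_wpM2l// lerD2l ler_wpM2r ?powR_ge0// le_min.
  apply/andP; split.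
    rewrite le_powRl ?(ltW (ratio_gt0 j2))// (meets_c_le i2 _ mi mj')//.
    exact: leq_trans im mj.
  apply: le_trans (ratio_powR_le j2) _; rewrite ler_wpM2l ?powR_ge0// le_powRNl ?ler_nat//.
  by apply: ltW; apply: lt_trans ts_gt1.
apply: coverable_le (coverable_bigcup Hp) _ _.
  move=> x [wx [j /=]]; rewrite geq_max => /andP[j2 mj] xj.
  exists j => //=; rewrite mj/=; have [-> |] := eqVneq j m.
    by rewrite -[X in (X < _)%N]addn0 ltn_add2l.
  move=> jm; have mltj : (m < j)%N by rewrite ltn_neqAle eq_sym jm.
  have mj1 := leq_pred_lt mltj.
  have mmj : meets a L j by exists x.
  (* The spread is bounded for [j.-1], so [j] may be as large as [m + n.+1]. *)
  have := index_spread m0 mj1 qmL (meets_q_diff m2 j2 mm mmj).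
  rewrite -natrB// -/X -(truncn_ge_nat _ X0) -/n leq_subLR => h.
  by rewrite -(prednK (ltnW j2)) !addnS !ltnS.
rewrite sumr_const_nat addKn.
have g1 := crossover_ge1 r01.
have rs := powR_ge0 r (- s).
set G := g r in g1 mg *; rewrite /B -/G.
set Y := L `^ e * r `^ (- s).
have Y0 : 0 <= Y by rewrite mulr_ge0 ?powR_ge0.
have hv1 : v * r `^ (- s) <= v1 * Y.
  rewrite /Y mulrA ler_wpM2r// ge_min; apply/orP; left.
  rewrite powR_div ?(ltW L0)// mulrC ler_wpM2l//.
  by apply: powR_le_e => //; left.
have hX : X <= D * G.
  rewrite ler_pM2l//.
  have mp : L * m%:R `^ p <= 2^-1.
    have mp0 := powR_gt0 p mR.
    have : 2 * L * m%:R `^ p <= q m * m%:R `^ p.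
      by apply: ler_wpM2r; rewrite ltW.
    rewrite powRN mulVf ?gt_eqF//; lra.
  rewrite powRDp// powRr1 ?(ltW mR)// mulrA.
  by have := ler_wpM2r (ltW mR) mp; lra.
have hv2 : X * (v * r `^ (- s)) <= v2 * Y.
  rewrite /Y !mulrA ler_wpM2r//.
  apply: le_trans (_ : X * (Ct `^ s * m%:R `^ (- (t * s))) <= _).
    by rewrite ler_wpM2l// ge_min lexx orbT.
  rewrite (_ : X * _ = v2 * (L * m%:R `^ (p + 1 - t * s))).
    by rewrite ler_wpM2l//; exact: few_pieces_power.
  by rewrite powRDp// /X /v2; ring.
have vr0 : 0 <= v * r `^ (- s) by rewrite mulr_ge0// le_min mulr_ge0 ?powR_ge0.
have nX := ler_wpM2r vr0 Xn.
rewrite -[leLHS]mulr_natr -addn2 natrD -!mulrA ler_wpM2l//.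
have : 0 <= (2 + D) * Y by rewrite mulr_ge0//; lra.
have : 0 <= (2 * v1 + v2) * G by rewrite mulr_ge0//; lra.
lra.
Qed.

(** Let [m] be the least index above [i] that the window meets. Either the remaining pieces lie
    within O(L) of 0, or [m] is below the crossover up to a factor and few pieces are met, or all of
    them are beyond the crossover and are covered as an interval. *)
Lemma coverable_rest : exists2 C : R, 1 <= C & forall a L r i j,
  (2 <= i)%N -> (i < j)%N -> meets a L i -> meets a L j ->
  0 < r <= 1 -> 0 < L <= 1 ->
  coverable r (window a L `&` far_pieces i.+1) (C * B L r).
Proof.
have [C1 C11 H1] := coverable_far_window.
have [C2 C21 H2] := coverable_few_pieces.
exists (2 + C1 + C2); first by lra.
move=> a L r i j i2 ij mi mj r01 L01; have B0 := window_bound_ge0 L r.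
have exm : exists m, (i < m)%N && `[< meets a L m >].
  by exists j; rewrite ij; apply/asboolP.
case: (ex_minnP exm) => m /andP[im /asboolP mm] m_min.
have m2 : (2 <= m)%N := leq_trans i2 (ltnW im).
have sub : window a L `&` far_pieces i.+1 `<=` window a L `&` far_pieces m.
  move=> x [wx [k /=]]; rewrite geq_max => /andP[k2 ik] xk; split => //.
  exists k => //=; rewrite geq_max k2/=; apply: m_min.
  by rewrite ik; apply/asboolP; exists x.
have [qmL|qmL] := leP (q m) (2 * L).
  apply: coverable_le (H1 m L r (ltnW m2) L01 qmL r01) _ _.
    by move=> x /sub[].
  by rewrite ler_wpM2r//; lra.
have [mg|mg] := leP m%:R (2 * g r).
  apply: coverable_le (H2 a L r i m i2 im mi mm L01 qmL r01 mg) _ _ => //.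
  by rewrite ler_wpM2r//; lra.
have g1 := crossover_ge1 r01.
have gm : g r <= m.-1%:R.
  by move: mg; rewrite -{1}(prednK (ltnW m2)) -natr1; lra.
have := coverable_far r01 gm; rewrite prednK ?(ltnW m2)// => /coverable_le; apply.
  by move=> x /sub[].
apply: le_trans (_ : 2 * B L r <= _); last by rewrite ler_wpM2r//; lra.
by rewrite ler_wpM2l// lerDl mulr_ge0 ?powR_ge0.
Qed.

(** A point in a piece of index [j > i] lies to the left of the piece of index [i]. Hence, after
    zooming into the latter, the window starts at or before 0 and [coverable_window0] applies. *)
Lemma coverable_first : exists2 C : R, 1 <= C & forall a L r i j,
  (2 <= i)%N -> (i < j)%N -> meets a L j ->
  0 < r <= 1 -> 0 < L <= 1 -> r <= L ->
  coverable r (window a L `&` piece i) (C * B L r).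
Proof.
have [C1 C11 H1] := coverable_window0.
exists (A + C1); first by have := A_ge1; lra.
move=> a L r i j i2 ij [y [_ /andP[ay _]] yj] r01 L01 rL.
have A1 := A_ge1; have B0 := window_bound_ge0 L r; have ci := ratio_gt0 i2.
have [cL|Lc] := leP (c i) L.
  apply: coverable_le (coverable_small_piece i2 L01 r01 cL) _ _.
    by move=> x [].
  by rewrite ler_wpM2r//; lra.
case/andP: r01 => r0 r1; case/andP: L01 => L0 L1.
apply: coverable_zoom => //.
have ai : (a - q i) / c i <= 0.
  rewrite ler_pdivrMr// mul0r subr_le0 (le_trans ay)//.
  apply: ltW; apply: lt_le_trans (piece_lt (leq_trans i2 (ltnW ij)) yj) _.
  by apply: left_end_anti; [exact: ltnW|exact: leq_pred_lt].
have Lci : 0 < L / c i <= 1 by rewrite divr_gt0//= ler_pdivrMr// mul1r ltW.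
have rci : 0 < r / c i <= 1.
  by rewrite divr_gt0//= ler_pdivrMr// mul1r ltW// (le_lt_trans rL).
apply: coverable_le (H1 _ _ _ ai Lci rci) _ _ => //.
have [xi /andP[xi0 xi1] cxi] := contraction_bound.
have ci1 : 0 < c i <= 1 by rewrite ci/= (le_trans (cxi i i2))// ltW.
apply: le_trans (_ : C1 * B L r <= _); last by rewrite ler_wpM2r//; lra.
by rewrite ler_wpM2l//; [lra | exact: window_bound_zoom].
Qed.

(** A window that meets a single piece longer than itself is zoomed. The bound does not increase, so
    one constant [C] serves all steps, and [L] grows by a factor at least 1 / xi each time, so the
    zooms end after at most [n] steps, where xi^n <= L. *)
Theorem coverable_window : exists2 C : R, 1 <= C & forall a L r,
  0 < r <= L -> L <= 1 -> coverable r (window a L) (C * B L r).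
Proof.
have [C1 C11 H1] := coverable_first.
have [C2 C21 H2] := coverable_rest.
have A1 := A_ge1.
have [xi /andP[xi0 xi1] cxi] := contraction_bound.
exists (A + C1 + C2); first by lra.
move=> a L r /andP[r0 rL] L1; have L0 := lt_le_trans r0 rL.
have [n hn] : exists n, xi ^+ n <= L.
  have /cvgr0_norm_le/(_ _ L0) [n _ /(_ n (leqnn n))] :=
    @cvg_expr _ xi ltac:(by rewrite gtr0_norm).
  by rewrite /= ger0_norm ?exprn_ge0 ?(ltW xi0)//; exists n.
elim: n => [|n IH] in a L r r0 rL L1 L0 hn *.
  have LE : L = 1 by apply/eqP; rewrite eq_le L1 -(expr0 xi).
  apply: coverable_le (A_box r0) _ _; first by move=> x [].
  apply: le_trans (_ : A * B L r <= _).
    rewrite ler_wpM2l// lerD//; last by rewrite LE powR1 mul1r.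
    by apply: crossover_ge1; rewrite r0 -LE.
  by rewrite ler_wpM2r ?window_bound_ge0//; lra.
have B0 := window_bound_ge0 L r.
have L01 : 0 < L <= 1 by rewrite L0.
have r01 : 0 < r <= 1 by rewrite r0 (le_trans rL).
have [[i0 i02 mi0]|nomeet] := pselect (exists2 i, (2 <= i)%N & meets a L i); last first.
  apply: coverable_le (coverable0 r (lexx 0)) _ _.
    move=> x wx; case: (wx) => /F_pieces[i i2 xi'] _.
    by apply: nomeet; exists i => //; exists x.
  by rewrite mulr_ge0//; lra.
have exi : exists i, (2 <= i)%N && `[< meets a L i >].
  by exists i0; rewrite i02; apply/asboolP.
case: (ex_minnP exi) => i /andP[i2 /asboolP mi] i_min {i0 i02 mi0 exi}.
have far x : window a L x -> far_pieces i x.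
  move=> wx; case: (wx) => /F_pieces[k k2 xk] _; exists k => //=.
  by rewrite geq_max k2/= i_min// k2; apply/asboolP; exists x.
have [[j ij mj]|single] := pselect (exists2 j, (i < j)%N & meets a L j).
  have := coverableU (H1 a L r i j i2 ij mj r01 L01 rL)
    (H2 a L r i j i2 ij mi mj r01 L01).
  move=> /coverable_le; apply.
    move=> x wx; case: (far x wx) => k /=; rewrite geq_max => /andP[k2].
    rewrite leq_eqVlt => /predU1P[<-|ik] xk; first by left.
    by right; split => //; exists k => //=; rewrite geq_max k2.
  by rewrite -mulrDl ler_wpM2r//; lra.
have sub : window a L `<=` window a L `&` piece i.
  move=> x wx; split => //; case: (far x wx) => k /=; rewrite geq_max => /andP[k2].
  rewrite leq_eqVlt => /predU1P[<-//|ik] xk.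
  by exfalso; apply: single; exists k => //; exists x.
have [cL|Lc] := leP (c i) L.
  apply: coverable_le (coverable_small_piece i2 L01 r01 cL) _ _.
    by move=> x /sub[].
  by rewrite ler_wpM2r//; lra.
have ci := ratio_gt0 i2.
apply: coverable_le sub (lexx _); apply: coverable_zoom => //.
have ci1 : 0 < c i <= 1 by rewrite ci/= (le_trans (cxi i i2))// ltW.
apply: (coverable_le (IH ((a - q i) / c i) (L / c i) (r / c i) _ _ _ _ _)) => //.
- by rewrite divr_gt0.
- by rewrite ler_pM2r ?invr_gt0.
- by rewrite ler_pdivrMr// mul1r ltW.
- by rewrite divr_gt0.
- rewrite ler_pdivlMr// (le_trans _ hn)// exprSr ler_wpM2l ?exprn_ge0 ?(ltW xi0)//.
  exact: cxi.
- by rewrite ler_wpM2l//; [lra | exact: window_bound_zoom].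
Qed.

End Upper.

(** * Lower bounds for the number of balls *)

Section Lower.
Hypothesis F_inhabited : F !=set0.
Variables s c0 r0 : R.
Hypothesis s_ge0 : 0 <= s.
Hypothesis c0_gt0 : 0 < c0.
Hypothesis r0_gt0 : 0 < r0.
Hypothesis F_lower : forall r (n : R), 0 < r <= r0 ->
  coverable r F n -> c0 * r `^ (- s) <= n.

(** At each small scale some ball of radius [rho], whose centre may depend on [rho], needs many
    small balls. This bounds the spectrum below by b / (1 / theta - 1). *)
Definition spectrum_lower (theta b : R) := exists C0 R0 : R,
  [/\ 0 < C0, 0 < R0 <= 1 & forall rho : R, 0 < rho <= R0 ->
    exists2 x, F x & forall n : R,
      coverable (rho `^ theta^-1) (ball x rho `&` F) n -> C0 * rho `^ (- b) <= n].

(** All points of [F] are positive, so 0 cannot serve as a centre. The ball is centred in the piece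
    of index [m.+1] and still contains the far pieces, because they all lie between 0 and [rho]. *)
Lemma near_zero (rho : R) : 0 < rho <= 1 -> exists m x,
  [/\ (0 < m)%N, rho `^ (- p^-1) <= m%:R, m%:R <= 2 * rho `^ (- p^-1), F x &
      far_pieces m.+1 `<=` ball x rho `&` F].
Proof.
move=> /[dup] rho01 /andP[rho0 rho1].
have h1 : 1 <= rho `^ (- p^-1) by rewrite powRN_ge1// invr_ge0 ltW.
have [m [m0 hm mh]] := exists_nat_between h1.
have qm : q m <= rho.
  apply: le_trans (le_powRNl _ hm (ltW p_gt0)) _; first by rewrite powR_gt0.
  by rewrite -powRrM mulrNN mulVf ?gt_eqF// powRr1// ltW.
have m2 : (2 <= m.+1)%N by [].
have bnd y : far_pieces m.+1 y -> 0 < y < rho.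
  move=> [i /=]; rewrite geq_max => /andP[i2 mi] yi.
  have /andP[h _] := piece_itv i2 yi; rewrite (lt_le_trans (left_end_gt0 (ltnW i2)) h)/=.
  apply: lt_le_trans (piece_lt i2 yi) (le_trans _ qm).
  by apply: left_end_anti => //; exact: leq_pred_lt.
have [y Fy] := F_inhabited.
have yp : piece m.+1 (c m.+1 * y + q m.+1) by exists y.
exists m, (c m.+1 * y + q m.+1); split => //; first exact: pieces_F yp.
move=> z zf; split; last first.
  by case: zf => i /=; rewrite geq_max => /andP[i2 _]; exact: pieces_F.
have /bnd : far_pieces m.+1 (c m.+1 * y + q m.+1).
  by exists m.+1 => //=; rewrite geq_max m2 leqnn.
by rewrite /ball /= ltr_norml; have := bnd z zf; lra.
Qed.

(** Between two pieces of even index lies the whole slot of a piece of odd index, so the tangent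
    bound separates them whatever the ratios are. *)
Lemma even_gap i j x y : (0 < i)%N -> (i < j)%N ->
  piece i.*2 x -> piece j.*2 y -> p * (j.*2)%:R `^ (- p - 1) <= x - y.
Proof.
case: j => // j i0; rewrite ltnS => ij xi yj.
have i2 : (2 <= i.*2)%N by rewrite -[2%N]/(1.*2) leq_double.
have j2 : (2 <= j.+1.*2)%N by [].
have j0 := leq_trans i0 ij.
have /andP[xq _] := piece_itv i2 xi; have yq := piece_lt j2 yj.
have qi : q j.*2 <= q i.*2 by apply: left_end_anti; rewrite ?double_gt0 ?leq_double.
have jR : 0 < (j.*2)%:R :> R by rewrite ltr0n double_gt0.
have := powR_tangent (ltW p_gt0) jR (ltr0Sn R j.*2).
rewrite -{1}natr1 addrAC subrr add0r mulr1 => ht.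
have : (j.+1.*2)%:R `^ (- p - 1) <= (j.*2.+1)%:R `^ (- p - 1).
  rewrite -opprD le_powRNl ?ltr0n// ?ler_nat//.
  by rewrite addr_ge0// ltW.
move: yq; rewrite doubleS /= => yq /(ler_wpM2l (ltW p_gt0)); lra.
Qed.

Lemma even_pieces_lower m n r (u N : R) (X : set R) : (0 < m)%N ->
  far_pieces m.+1 `<=` X ->
  2 * r <= p * (n.*2)%:R `^ (- p - 1) ->
  (forall k, (m < k < n.+1)%N -> forall N' : R, coverable r (piece k.*2) N' -> u <= N') ->
  coverable r X N -> (n - m)%:R * u <= N.
Proof.
move=> m0 farX rsep hu [l lN Xl]; apply: le_trans lN.
rewrite -subSS; apply: (@separated_cover_size R r u (fun k => piece k.*2)) => //.
- move=> i j x y /andP[mi _] ij jn xi yj.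
  apply: le_trans rsep _; apply: le_trans (ler_norm _).
  have i0 := leq_ltn_trans (leq0n m) mi.
  apply: le_trans _ (even_gap i0 ij xi yj); rewrite ler_wpM2l ?(ltW p_gt0)//.
  rewrite -opprD le_powRNl ?ltr0n ?ler_nat ?leq_double ?double_gt0//.
    exact: leq_ltn_trans (leq0n i) ij.
  by rewrite addr_ge0// ltW.
- move=> k /andP[mk _]; apply: subset_trans Xl; apply: subset_trans farX.
  move=> x xk; exists k.*2 => //=; rewrite geq_max.
  have k0 := leq_ltn_trans (leq0n m) mk.
  rewrite -{1}[2%N]/(1.*2) leq_double k0/= -addnn.
  by apply: leq_trans mk (leq_addr _ _).
Qed.

(** One ball per piece: the even pieces of index up to about [g r] are separated by [2 * r], and
    theta < p / (1 + p) makes [g r] much larger than the first index [m], which is about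
    rho^(-1/p). *)
Lemma spectrum_lower_points (theta : R) : 0 < theta < p / (1 + p) ->
  spectrum_lower theta ((1 + p)^-1 / theta).
Proof.
move=> /andP[th0 thp]; have p1 := p1_gt0.
(* Chosen so that n <= D g r implies 2r <= p (2n)^(-p-1). *)
pose D := (p / 2) `^ (1 + p)^-1 / 2.
have D0 : 0 < D by rewrite divr_gt0// powR_gt0// divr_gt0.
have ex0 : 0 < (1 + p)^-1 / theta - p^-1.
  by rewrite subr_gt0 ltr_pdivlMr// mulrC -ltr_pdivlMr ?invr_gt0// invrK mulrC.
(* Once rho^(-1/p) is at most [D / 6] times [g r], the index [m] and the rounding of [n] together
   cost at most half of [D * g r]. *)
have D6 : 0 < D / 6 by rewrite divr_gt0.
have [R0 R01 hR0] := powR_small ex0 D6.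
exists (D / 2), R0; split => //; first by rewrite divr_gt0.
move=> rho /[dup] rhoR0 /andP[rho0 rhole].
have rho01 : 0 < rho <= 1 by rewrite rho0 (le_trans rhole)//; case/andP: R01.
have [m [x [m0 _ mh Fx farx]]] := near_zero rho01.
exists x => // N covN.
set r := rho `^ theta^-1 in covN.
have r_gt0 : 0 < r by rewrite powR_gt0.
have gr : g r = rho `^ (- ((1 + p)^-1 / theta)).
  by rewrite -powRrM mulrN mulrC.
have Dg0 : 0 <= D * g r by rewrite mulr_ge0 ?powR_ge0// ltW.
have /andP[h1 h2] := truncn_itv Dg0; set n := Num.truncn _ in h1 h2.
have ph : rho `^ (- p^-1) <= D / 6 * g r.
  have := ler_wpM2r (powR_ge0 rho (- ((1 + p)^-1 / theta))) (hR0 rho rhoR0).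
  rewrite -powRDp// gr; congr (_ `^ _ <= _); ring.
have n0 : (0 < n)%N.
  rewrite -(ltr_nat R); have : 1 <= rho `^ (- p^-1).
    by rewrite powRN_ge1// invr_ge0 ltW.
  by move: h2; rewrite -natr1; lra.
have sep : 2 * r <= p * (n.*2)%:R `^ (- p - 1).
  have nle : (n.*2)%:R <= (p / 2) `^ (1 + p)^-1 * g r.
    by rewrite -muln2 natrM; move: h1; rewrite /D; lra.
  have : ((p / 2) `^ (1 + p)^-1 * g r) `^ (- (1 + p)) <= (n.*2)%:R `^ (- (1 + p)).
    by apply: le_powRNl => //; [rewrite ltr0n double_gt0 | exact: ltW].
  have gp : g r `^ (- (1 + p)) = r.
    by rewrite -[LHS]powRrM mulrNN mulVf ?gt_eqF// powRr1 ?(ltW r_gt0).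
  rewrite powRM ?powR_ge0// gp -powRrM mulrN mulVf ?gt_eqF//.
  rewrite powR_inv1 ?divr_ge0 ?(ltW p_gt0)// invf_div => h.
  rewrite -opprD [p + 1]addrC.
  have := ler_wpM2l (ltW p_gt0) h.
  by rewrite mulrA mulrCA divff ?gt_eqF// mulr1.
have := @even_pieces_lower m n r 1 N _ m0 farx sep _ covN.
rewrite mulr1 => /(_ _)/wrap[].
  move=> k /andP[mk _] N' [l lN' kl]; apply: le_trans lN'.
  have [y Fy] := F_inhabited.
  have /kl[z + _] : piece k.*2 (c k.*2 * y + q k.*2) by exists y.
  by case: l {kl} => // z' l _; rewrite ler1n.
apply: le_trans; rewrite -gr.
have nm : n%:R - m%:R <= (n - m)%:R :> R.
  have [/natrB->//|mn] := leqP m n.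
  by rewrite (le_trans _ (ler0n _ _))// subr_le0 ler_nat ltnW.
have : 1 <= rho `^ (- p^-1) by rewrite powRN_ge1// invr_ge0 ltW.
by move: h2; rewrite -natr1; lra.
Qed.

Lemma F_lower_affine (k b r n : R) : 0 < k -> 0 < r -> r <= r0 * k ->
  coverable r [set k * y + b | y in F] n -> c0 * (k `^ s * r `^ (- s)) <= n.
Proof.
move=> k0 r_gt0 rk; rewrite -{1}(divfK (lt0r_neq0 k0) r) [r / k * k]mulrC.
move=> /(coverable_affineE _ _ _ _ k0) /F_lower; rewrite div_powR//; apply.
by rewrite divr_gt0//= ler_pdivrMr.
Qed.

(** Cylinders of the word 2...2 provide copies of [F] at every scale up to the factor [c 2], and
    [F_lower] applies to each of them. *)
Lemma spectrum_lower_dim (theta : R) : 0 < theta < 1 ->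
  spectrum_lower theta (s * (theta^-1 - 1)).
Proof.
move=> /andP[th0 th1]; have c2 := ratio_gt0 (leqnn 2).
have ex0 : 0 < theta^-1 - 1 by rewrite subr_gt0 invf_gt1.
have e0 : 0 < r0 * c 2 by rewrite mulr_gt0.
have [R0 R01 hR0] := powR_small ex0 e0.
exists (c0 * c 2 `^ s), R0; split => //; first by rewrite mulr_gt0// powR_gt0.
move=> rho /[dup] rhoR0 /andP[rho0 rhole].
have rho1 : rho <= 1 by apply: le_trans rhole _; case/andP: R01.
have [xi /andP[xi0 xi1] cxi] := contraction_bound.
have c21 : c 2 < 1 := le_lt_trans (cxi 2 (leqnn 2)) xi1.
have exn : exists n, c 2 ^+ n <= rho.
  have /cvgr0_norm_le/(_ _ rho0) [n _ /(_ n (leqnn n))] :=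
    @cvg_expr _ (c 2) ltac:(by rewrite gtr0_norm).
  by rewrite /= ger0_norm ?exprn_ge0 ?(ltW c2)//; exists n.
case: (ex_minnP exn) => n nrho n_min.
(* By minimality of [n] the copy is smaller than [rho] by at most the factor [c 2]. *)
have rhon : c 2 * rho <= c 2 ^+ n.
  case: n nrho n_min => [|n] _ n_min.
    by rewrite expr0 mulr_ile1// ltW.
  rewrite exprS ler_pM2l// leNgt; apply/negP => /ltW /n_min.
  by rewrite ltnn.
(* [b] is the translation part of the n-th iterate of the map of index 2. *)
have [b Hb] : exists b, forall y, F y -> F (c 2 ^+ n * y + b).
  elim: n {nrho n_min rhon} => [|n [b Hb]].
    by exists 0 => y Fy; rewrite expr0 mul1r addr0.
  exists (c 2 * b + q 2) => y /Hb Fy; apply: (pieces_F (leqnn 2)).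
  by exists (c 2 ^+ n * y + b) => //; rewrite exprS; ring.
have [y0 Fy0] := F_inhabited.
have k0 : 0 < c 2 ^+ n by rewrite exprn_gt0.
exists (c 2 ^+ n * y0 + b); first exact: Hb.
move=> N /coverable_le covN.
have : coverable (rho `^ theta^-1) [set c 2 ^+ n * y + b | y in F] N.
  apply: covN => // _ [y Fy <-]; split; last exact: Hb.
  rewrite /ball /= (_ : _ - _ = c 2 ^+ n * (y0 - y)); last by ring.
  rewrite normrM gtr0_norm//; apply: lt_le_trans nrho; rewrite gtr_pMr//.
  have := F_le Fy; have := F_le Fy0; have := end_gap_gt0.
  have := F01 Fy; have := F01 Fy0.
  by rewrite ltr_norml; lra.
have rpow : rho `^ theta^-1 = rho `^ (theta^-1 - 1) * rho.
  by rewrite -[X in _ * X](powRr1 (ltW rho0)) -powRDp// subrK.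
have rk : rho `^ theta^-1 <= r0 * c 2 ^+ n.
  rewrite rpow; apply: le_trans (ler_wpM2r (ltW rho0) (hR0 rho rhoR0)) _.
  by rewrite -mulrA ler_pM2l.
move=> /(F_lower_affine k0 (powR_gt0 _ rho0) rk); apply: le_trans.
rewrite -mulrA ler_pM2l// -powRrM.
apply: le_trans (_ : (c 2 * rho) `^ s * rho `^ (theta^-1 * - s) <= _).
  rewrite powRM ?(ltW c2) ?(ltW rho0)// -mulrA ler_wpM2l ?powR_ge0// -powRDp//.
  by rewrite le_eqVlt; apply/orP; left; apply/eqP; congr (_ `^ _); ring.
by rewrite ler_wpM2r ?powR_ge0// le_powRl// ltW// mulr_gt0.
Qed.

(** For these [theta] the far pieces are dense at scale [r] below [q m.+1], so balls of radius [r]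
    covering them, enlarged by the factor [1 + p], cover an interval of length comparable to
    [rho]. *)
Lemma spectrum_lower_full (theta : R) : p / (1 + p) <= theta < 1 ->
  spectrum_lower theta (theta^-1 - 1).
Proof.
move=> /andP[thp th1]; have p1 := p1_gt0; have p0 := p_gt0.
have th0 : 0 < theta by apply: lt_le_trans thp; rewrite divr_gt0.
have ex0 : 0 < theta^-1 - 1 by rewrite subr_gt0 invf_gt1.
(* [q m.+1] is at least 4^-p rho; division by the spacing 2 (1 + p) r of the test points below gives
   D rho / r. *)
pose D := 4 `^ (- p) / (2 * (1 + p)) : R.
have D0 : 0 < D by rewrite divr_gt0// ?powR_gt0// mulr_gt0.
have D2 : 0 < D / 2 by rewrite divr_gt0.
have [R0 R01 hR0] := powR_small ex0 D2.
exists (D / 2), R0; split => //.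
move=> rho /[dup] rhoR0 /andP[rho0 rhole].
have rho01 : 0 < rho <= 1 by rewrite rho0 (le_trans rhole)//; case/andP: R01.
have [m [x [m0 mg mh Fx farx]]] := near_zero rho01.
exists x => // N [l lN Xl]; apply: le_trans lN.
set r := rho `^ theta^-1 in Xl.
have r_gt0 : 0 < r by rewrite powR_gt0.
have mR : 0 < m%:R :> R by rewrite ltr0n.
have mr : m%:R `^ (- p - 1) <= r.
  rewrite -opprD; apply: le_trans (le_powRNl _ mg _) _; first by rewrite powR_gt0.
    by rewrite addr_ge0// ltW.
  rewrite -powRrM ger_powR//.
  rewrite mulrNN mulrC -invf_div lef_pV2 ?posrE ?divr_gt0//; last by rewrite addr_gt0.
  by rewrite [p + 1]addrC.
(* The point [y] lies in a slot from [q i] to [q i.-1], of length at most p r, and this slot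
   contains a point of [F], which is within [r] of a centre. *)
have l_cover y : 0 < y <= q m.+1 -> exists2 z, z \in l & `|z - y| < (1 + p) * r.
  move=> /andP[y0 yq].
  have exi : exists i, (0 < i)%N && (q i < y).
    have [e /andP[e0 e1] he] := @powR_small R p (y / 2) p_gt0 (ltac:(rewrite divr_gt0//)).
    have [|i [i0 ei _]] := @exists_nat_between R e^-1; first by rewrite invf_ge1.
    exists i; rewrite i0/=; apply: le_lt_trans (_ : y / 2 < y); last by lra.
    apply: le_trans (le_powRNl _ ei (ltW p_gt0)) _; first by rewrite invr_gt0.
    by rewrite -(powR_inv1 (ltW e0)) -powRrM mulrNN mul1r he// e0/=.
  case: (ex_minnP exi) => i /andP[i0 qiy] i_min.
  have mi : (m.+1 < i)%N.
    rewrite ltnNge; apply/negP => im.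
    by have := left_end_anti i0 im; rewrite leNgt (lt_le_trans qiy).
  have i2 : (2 <= i)%N by apply: leq_trans mi.
  have i1 := leq_pred_lt mi.
  have yq1 : y <= q i.-1.
    rewrite leNgt; apply/negP => h.
    have : (i <= i.-1)%N by apply: i_min; rewrite h andbT (leq_trans _ i1).
    by rewrite leqNgt ltn_predL i0.
  have [w Fw] := F_inhabited.
  have zi : piece i (c i * w + q i) by exists w.
  set z := _ + _ in zi.
  have /farx/Xl[v /= vl vz] : far_pieces m.+1 z.
    by exists i => //=; rewrite geq_max i2 ltnW.
  exists v => //; rewrite /ball /= in vz.
  have i10 : 0 < i.-1%:R :> R by rewrite ltr0n (leq_trans _ i1).
  have iR : 0 < i%:R :> R by rewrite ltr0n.
  have tan := powR_tangent (ltW p_gt0) iR i10.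
  rewrite -[in X in _ - X](prednK i0) -natr1 in tan.
  have mi1 : m%:R <= i.-1%:R :> R by rewrite ler_nat ltnW.
  have : i.-1%:R `^ (- p - 1) <= m%:R `^ (- p - 1).
    by rewrite -opprD le_powRNl// addr_ge0// ltW.
  move=> /(ler_wpM2l (ltW p_gt0)) h1.
  have h2 := ler_wpM2l (ltW p_gt0) mr.
  have := piece_lt i2 zi; have /andP[+ _] := piece_itv i2 zi => h3 h4.
  move: tan vz; rewrite !ltr_norml; lra.
set D' := (1 + p) * r.
have D'0 : 0 < D' by rewrite mulr_gt0.
have y0 : 0 <= q m.+1 / (2 * D') by rewrite divr_ge0 ?powR_ge0// mulr_ge0// ltW.
have /andP[h1 h2] := truncn_itv y0; set n := Num.truncn _ in h1 h2.
(* The multiples of 2D' serve as test points; each of them needs its own centre. *)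
have := @separated_cover_size R D' 1 (fun k => [set k%:R * (2 * D')]) 1 n.+1 l.
rewrite mulr1 subn1 /= => /(_ _ _ _)/wrap[].
- move=> i j _ _ _ ij _ -> ->; rewrite -mulrBl normrM [`|2 * D'|]gtr0_norm ?mulr_gt0//.
  apply: ler_peMl; first by rewrite ltW// mulr_gt0.
  by rewrite distrC -natrB ?(ltnW ij)// normr_nat ler1n subn_gt0.
- move=> k _ N' [l' + kl]; apply: le_trans.
  have /kl[z + _] : [set k%:R * (2 * D')] (k%:R * (2 * D')) by [].
  by case: l' {kl} => // z' l' _; rewrite ler1n.
- move=> k /andP[k1 kn] _ ->; apply: l_cover.
  rewrite mulr_gt0 ?ltr0n ?mulr_gt0//= -ler_pdivlMr ?mulr_gt0//.
  by apply: le_trans h1; rewrite ler_nat.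
apply: le_trans.
suff : D * rho <= (n%:R + 1) * r.
  have rpow : r = rho `^ (theta^-1 - 1) * rho.
    by rewrite -[X in _ * X](powRr1 (ltW rho0)) -powRDp// subrK.
  have : 0 < rho `^ (theta^-1 - 1) by rewrite powR_gt0.
  rewrite rpow mulrA ler_pM2r// powRN; have := hR0 rho rhoR0.
  set z := _ `^ _ => hz z0.
  rewrite -ler_pdivrMr// -[_ / z]mulr1; have : 1 <= D / 2 / z by rewrite ler_pdivlMr// mul1r.
  by lra.
apply: le_trans (_ : q m.+1 / (2 * D') * r <= _); last first.
  by rewrite ler_pM2r// natr1 ltW.
have -> : q m.+1 / (2 * D') * r = q m.+1 / (2 * (1 + p)).
  by rewrite /D'; field; rewrite !gt_eqF.
rewrite /D mulrAC ler_pM2r ?invr_gt0 ?mulr_gt0//.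
have m1 : m.+1%:R <= 4 * rho `^ (- p^-1).
  have : 1 <= m%:R :> R by rewrite ler1n.
  by rewrite -natr1; lra.
apply: le_trans (le_powRNl _ m1 (ltW p_gt0)); last by rewrite ltr0n.
rewrite powRM ?powR_ge0// -powRrM mulrNN mulVf ?gt_eqF// powRr1//.
exact: ltW.
Qed.

(** The [m] even pieces with index above 2m and up to 4m have ratios of order rho^(t/p). For theta <
    p / t the radius [r] is much smaller, so each of them counts as a whole copy of [F]. *)
Lemma spectrum_lower_pieces (theta : R) N : 0 < theta < p / t ->
  (forall i, (N <= i)%N -> (2 <= i)%N -> c i = p * i%:R `^ (- t)) ->
  spectrum_lower theta (s / theta - (t * s - 1) / p).
Proof.
move=> /andP[th0 thp] cE; have p0 := p_gt0; have ht := t_ge.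
have t0 : 0 < t by lra.
have ex1 : 0 < theta^-1 - t / p.
  by rewrite subr_gt0 -invf_div ltf_pV2 ?posrE ?divr_gt0.
(* Indices up to 4m are at most 8 rho^(-1/p), which yields [k] for the ratios and, below, [D] for
   the separation. *)
pose k := p * 8 `^ (- t) : R.
have k0 : 0 < k by rewrite mulr_gt0// powR_gt0.
pose D := p * 8 `^ (- (p + 1)) / 2 : R.
have D0 : 0 < D by rewrite divr_gt0// mulr_gt0// powR_gt0.
have e0 : 0 < Num.min (r0 * k) D by rewrite lt_min D0 mulr_gt0.
have [R0 /andP[R00 R01] hR0] := powR_small ex1 e0.
(* The second bound forces [N <= m], so that the formula for [c] applies to all the pieces
   counted. *)
pose R1 := Num.min R0 (N.+1%:R `^ (- p)).
have R10 : 0 < R1 by rewrite lt_min R00 powR_gt0// ltr0n.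
exists (c0 * k `^ s), R1; split => //.
- by rewrite mulr_gt0// powR_gt0.
- by rewrite R10 ge_min R01.
move=> rho /andP[rho0]; rewrite le_min => /andP[rhole rhoN].
have rhoR0 : 0 < rho <= R0 by rewrite rho0.
have rho01 : 0 < rho <= 1 by rewrite rho0 (le_trans rhole).
have [m [x [m0 mg mh Fx farx]]] := near_zero rho01.
exists x => // N' covN.
have Nm : (N <= m)%N.
  rewrite ltnW// -(ler_nat R); apply: le_trans mg.
  have <- : (N.+1%:R `^ (- p)) `^ (- p^-1) = N.+1%:R :> R.
    by rewrite -powRrM mulrNN mulfV ?gt_eqF// powRr1.
  by rewrite le_powRNl// invr_ge0 ltW.
set r := rho `^ theta^-1 in covN.
have r_gt0 : 0 < r by rewrite powR_gt0.
have := hR0 rho rhoR0; rewrite le_min => /andP[hr hD].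
have rE : r = rho `^ (theta^-1 - t / p) * rho `^ (t / p) by rewrite -powRDp// subrK.
have m4 i : (i <= m.*2.*2)%N -> i%:R <= 8 * rho `^ (- p^-1).
  move=> im; apply: le_trans (_ : (m.*2.*2)%:R <= _); first by rewrite ler_nat.
  by rewrite -!muln2 !natrM; lra.
have sep : 2 * r <= p * (m.*2.*2)%:R `^ (- p - 1).
  have h : (8 * rho `^ (- p^-1)) `^ (- (p + 1)) <= (m.*2.*2)%:R `^ (- (p + 1)).
    apply: le_powRNl; [by rewrite ltr0n !double_gt0 | exact: m4 |].
    by rewrite addr_ge0// ltW.
  rewrite -opprD; apply: le_trans (ler_wpM2l (ltW p_gt0) h).
  rewrite powRM ?powR_ge0// -powRrM mulrNN.
  have : r <= D * rho `^ (p^-1 * (p + 1)).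
    rewrite rE; apply: le_trans (ler_wpM2r (powR_ge0 _ _) hD) _.
    rewrite ler_pM2l// ger_powR// mulrC ler_pM2r ?invr_gt0//.
  rewrite /D; set u := rho `^ (p^-1 * _); lra.
have := @even_pieces_lower m m.*2 r (c0 * (k `^ s * (rho `^ (t / p) `^ s * r `^ (- s))))
  N' _ m0 farx sep _ covN.
move=> /(_ _)/wrap[].
  move=> i /andP[mi im] n'.
  have i2 : (2 <= i.*2)%N by rewrite -[2%N]/(1.*2) leq_double (leq_ltn_trans _ mi).
  have Ni : (N <= i.*2)%N.
    by rewrite (leq_trans Nm)// (leq_trans (ltnW mi))// -addnn leq_addr.
  have ci := ratio_gt0 i2.
  have kc : k * rho `^ (t / p) <= c i.*2.
    rewrite cE// -mulrA ler_pM2l//.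
    have -> : 8 `^ (- t) * rho `^ (t / p) = (8 * rho `^ (- p^-1)) `^ (- t).
      by rewrite powRM ?powR_ge0// -powRrM mulrNN [p^-1 * _]mulrC.
    apply: le_powRNl; [by rewrite ltr0n (ltnW i2) | | exact: ltW].
    by apply: m4; rewrite leq_double.
  have rk : r <= r0 * c i.*2.
    rewrite rE; apply: le_trans (ler_wpM2r (powR_ge0 _ _) hr) _.
    by rewrite -mulrA ler_pM2l.
  move=> /(F_lower_affine ci r_gt0 rk); apply: le_trans.
  rewrite ler_pM2l// mulrA ler_wpM2r ?powR_ge0//.
  rewrite -powRM ?powR_ge0 ?(ltW k0)// le_powRl// mulr_ge0 ?powR_ge0// ltW//.
apply: le_trans.
have -> : (m.*2 - m)%N = m by rewrite -addnn addnK.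
have -> : rho `^ (- (s / theta - (t * s - 1) / p)) =
    rho `^ (- p^-1) * (rho `^ (t / p) `^ s * r `^ (- s)).
  by rewrite -!powRrM -!powRDp//; congr (_ `^ _); ring.
set z := _ `^ s * _; have z0 : 0 <= z by rewrite mulr_ge0 ?powR_ge0.
have : 0 <= c0 * k `^ s * z by rewrite !mulr_ge0 ?powR_ge0// ltW.
by move=> /ler_wpM2l/(_ _ _ mg); lra.
Qed.

End Lower.

(** * From covering bounds to the Assouad spectrum and the box dimension *)

Lemma spectrum_lowerP (theta b : R) : 0 < theta < 1 -> spectrum_lower theta b ->
  ((b / (theta^-1 - 1))%:E <= assouad_spectrum_interior theta F)%E.
Proof.
move=> /andP[th0 th1] [C0 [R0 [C00 /andP[R00 R01] H]]].
have ex0 : 0 < theta^-1 - 1 by rewrite subr_gt0 invf_gt1.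
apply: le_ereal_inf_tmp => _ [alpha [C C_gt0 HC] <-].
rewrite lee_fin ler_pdivrMr//.
apply: (@powR_exponent_le R R0 C0 (2 * C)) => // r /andP[r_gt0 rR0].
have [x Fx] := H r (introT andP (conj r_gt0 rR0)).
rewrite -mulrA; apply.
have -> : - (alpha * (theta^-1 - 1)) = alpha * (1 - theta^-1) by ring.
apply: covering_number_coverable; first by rewrite mulr_gt0// powR_gt0.
by apply: HC => //; rewrite r_gt0 (le_trans rR0).
Qed.

Lemma spectrum_le (theta alpha : R) (C : R) : 0 < C ->
  (forall x rho, F x -> 0 < rho <= 1 ->
    coverable (rho `^ theta^-1) (ball x rho `&` F)
      (C * rho `^ (alpha * (1 - theta^-1)))) ->
  (assouad_spectrum_interior theta F <= alpha%:E)%E.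
Proof.
move=> C0 H; apply: ereal_inf_lbound; exists alpha => //; exists C => // x rho Fx rho01.
by apply: covering_number_le; exact: H.
Qed.

Lemma spectrum_le1 (theta : R) : 0 < theta < 1 ->
  (assouad_spectrum_interior theta F <= 1%:E)%E.
Proof.
move=> /andP[th0 th1].
have ex0 : 0 < theta^-1 - 1 by rewrite subr_gt0 invf_gt1.
apply: (@spectrum_le _ _ 3) => // x rho Fx /[dup] rho01 /andP[rho0 rho1].
have r0 : 0 < rho `^ theta^-1 by rewrite powR_gt0.
have xr : x - rho <= x + rho by lra.
apply: coverable_le (coverable_itv r0 xr) _ _.
  by move=> y [+ _]; rewrite /ball /= ltr_norml => h; lra.
have -> : x + rho - (x - rho) = 2 * rho by ring.
have -> : 2 * rho / rho `^ theta^-1 = 2 * rho `^ (1 - theta^-1).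
  by rewrite -mulrA -powRN -[X in 2 * (X * _)](powRr1 (ltW rho0)) -powRDp.
have : 1 <= rho `^ (1 - theta^-1).
  by rewrite -opprB powRN_ge1// ltW.
by rewrite mul1r; lra.
Qed.

(** A ball of radius [rho] lies in two windows of length [rho]. The first exponent inequality
    handles the crossover term of [window_bound], the other two handle its second term for either
    value of the minimum. *)
Lemma spectrum_le_window (theta alpha s C : R) : 0 < theta < 1 -> 0 < C ->
  (forall x L r, 0 < r <= L -> L <= 1 ->
    coverable r (window x L) (C * window_bound s L r)) ->
  (1 + p)^-1 / theta <= alpha * (theta^-1 - 1) ->
  s * (theta^-1 - 1) <= alpha * (theta^-1 - 1) ->
  s / theta - (t * s - 1) / p <= alpha * (theta^-1 - 1) ->
  (assouad_spectrum_interior theta F <= alpha%:E)%E.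
Proof.
move=> /andP[th0 th1] C0 HC a1 a2 a3.
have th : 1 <= theta^-1 by rewrite ltW// invf_gt1.
apply: (@spectrum_le _ _ (4 * C)); first by rewrite mulr_gt0.
move=> x rho Fx /[dup] rho01 /andP[rho0 rho1].
have r0 : 0 < rho `^ theta^-1 by rewrite powR_gt0.
have r_le : 0 < rho `^ theta^-1 <= rho by rewrite r0 ge1r_powR.
have := coverableU (HC (x - rho) rho _ r_le rho1) (HC x rho _ r_le rho1).
move=> /coverable_le; apply.
  move=> y [+ Fy]; rewrite /ball /= ltr_norml => xy.
  have [yx|xy'] := leP y x; [left|right]; split => //; lra.
suff : window_bound s rho (rho `^ theta^-1) <= 2 * rho `^ (alpha * (1 - theta^-1)).
  by move=> /(ler_wpM2l (ltW C0)); lra.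
rewrite /window_bound mulr_natl mulr2n lerD//.
  by rewrite -powRrM ger_powR//; lra.
rewrite -powRrM -powRDp// ger_powR//.
by rewrite addrC -lerBlDl; case: (leP s _) => _; lra.
Qed.

Lemma nbhs_right_itv (e : R) : 0 < e -> \forall r \near (0 : R)^'+, 0 < r < e.
Proof.
move=> e0; near=> r; apply/andP; split; near: r.
  exact: nbhs_right_gt.
exact: nbhs_right_lt.
Unshelve. all: by end_near. Qed.

Lemma upper_box_dim_le (s A : R) : 0 <= s -> 1 <= A ->
  (forall r, 0 < r -> coverable r F (A * (1 + r `^ (- s)))) ->
  forall e : R, 0 < e -> (upper_box_dim F <= (s + e)%:E)%E.
Proof.
move=> s0 A1 HA e e0.
have e2 : 0 < e / 2 by rewrite divr_gt0.
have A0 : 0 < A by apply: lt_le_trans A1.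
(* Below [R0] the constant [2 * A] is at most r^(-e/2). *)
have [R0 /andP[R00 R01] hR0] := @powR_small R (e / 2) (2 * A)^-1 e2
  ltac:(by rewrite invr_gt0 mulr_gt0).
(* The bound 1/2 keeps [r < 1], so that [- ln r] is positive. *)
pose R1 := Num.min R0 2^-1.
have R10 : 0 < R1 by rewrite lt_min R00 invr_gt0 ltr0n.
pose U := [set r : R | 0 < r < R1].
pose G := fun r : R => (lne (covering_number r F) * ((- ln r)^-1)%:E)%E.
apply: (@le_trans _ _ (ereal_sup (G @` U))).
  by apply: ereal_inf_lbound; exists U => //; exact: nbhs_right_itv.
apply: ge_ereal_sup => y [r /= /andP[r0]].
rewrite lt_min => /andP[rR0 r12] <- {y}; rewrite /G.
have r1 : r < 1 by apply: lt_trans r12 _; rewrite invf_lt1// ltr1n.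
have lnr : 0 < - ln r by rewrite oppr_gt0 ln_lt0// r0.
have cov : (covering_number r F <= (r `^ (- (s + e / 2)))%:E)%E.
  apply: le_trans (covering_number_le (HA r r0)) _; rewrite lee_fin.
  have rs1 : 1 <= r `^ (- s) by rewrite powRN_ge1// r0 ltW.
  apply: le_trans (_ : 2 * A * r `^ (- s) <= _).
    by have := ler_wpM2l (ltW A0) rs1; lra.
  rewrite opprD powRDp// mulrC ler_pM2l ?powR_gt0// powRN.
  rewrite -[leLHS]invrK lef_pV2 ?posrE ?invr_gt0 ?mulr_gt0 ?powR_gt0//.
  by apply: hR0; rewrite r0 ltW.
rewrite -[leRHS]mule1.
apply: le_trans (_ : (lne (r `^ (- (s + e / 2)))%:E * ((- ln r)^-1)%:E <= _)%E).
  apply: lee_wpmul2r; first by rewrite lee_fin invr_ge0 ltW.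
  rewrite lee_lne ?in_itv/= ?leey ?andbT//; last by rewrite lee_fin powR_ge0.
  by apply: le_ereal_inf_tmp => _ [l _ <-]; rewrite lee_fin.
rewrite lne_EFin ?powR_gt0// ln_powR mule1 -EFinM lee_fin.
have -> : - (s + e / 2) * ln r / - ln r = s + e / 2.
  by field; rewrite -oppr_eq0 gt_eqF.
lra.
Qed.

Lemma upper_box_dim_ge (s c0 r0 : R) : 0 < c0 -> 0 < r0 ->
  (forall r (n : R), 0 < r <= r0 -> coverable r F n -> c0 * r `^ (- s) <= n) ->
  forall e : R, 0 < e -> ((s - e)%:E <= upper_box_dim F)%E.
Proof.
move=> c00 r00 H e e0.
apply: le_ereal_inf_tmp => _ [U U0 <-].
have [R0 /andP[R00 R01] hR0] := powR_small e0 c00.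
pose R1 := Num.min r0 (Num.min R0 2^-1).
have R10 : 0 < R1 by rewrite !lt_min r00 R00 invr_gt0 ltr0n.
have [r [Ur /andP[r_gt0]]] : exists r, U r /\ 0 < r < R1.
  have /filter_ex[r [? ?]] : \forall r \near 0^'+, U r /\ 0 < r < R1.
    by apply: filterI => //; exact: nbhs_right_itv.
  by exists r.
rewrite !lt_min => /and3P[rr0 rR0 r12].
have r1 : r < 1 by apply: lt_trans r12 _; rewrite invf_lt1// ltr1n.
have lnr : 0 < - ln r by rewrite oppr_gt0 ln_lt0// r_gt0.
apply: le_trans (_ : (lne (covering_number r F) * ((- ln r)^-1)%:E <= _)%E); last first.
  by apply: ereal_sup_ubound; exists r.
apply: le_trans (_ : (lne (r `^ (- (s - e)))%:E * ((- ln r)^-1)%:E <= _)%E).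
  rewrite lne_EFin ?powR_gt0// ln_powR -EFinM lee_fin.
  have -> : - (s - e) * ln r / - ln r = s - e.
    by field; rewrite -oppr_eq0 gt_eqF.
  exact: lexx.
apply: lee_wpmul2r; first by rewrite lee_fin invr_ge0 ltW.
rewrite lee_lne ?in_itv/= ?leey ?andbT//; last 2 first.
- by rewrite lee_fin powR_ge0.
- by apply: le_ereal_inf_tmp => _ [l _ <-]; rewrite lee_fin.
apply: le_ereal_inf_tmp => _ [l lF <-]; rewrite lee_fin.
apply: le_trans (H r (size l)%:R _ _); last by exists l.
  rewrite opprB addrC powRDp// mulrC ler_pM2r ?powR_gt0//.
  by apply: hR0; rewrite r_gt0 ltW.
by rewrite r_gt0 ltW.
Qed.

End SelfSimilarSet.

(** * Hausdorff content, counting and weighted covers *)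

Section HausdorffContent.
Variable R : realType.
Implicit Types (E : set R) (s r e : R).

Lemma diam_ub E x y : E x -> E y -> (`|x - y|%:E <= diam E)%E.
Proof. by move=> Ex Ey; apply: ereal_sup_ubound; exists (x, y). Qed.

Lemma diam_ball x r : (diam (ball x r) <= (2 * r)%:E)%E.
Proof.
apply: ge_ereal_sup => d [[y z]] [/=]; rewrite /ball /= => xy xz <- {d}.
rewrite lee_fin; have -> : y - z = (x - z) - (x - y) by ring.
by apply: le_trans (ler_normB _ _) _; lra.
Qed.

Lemma hausdorff_content_ge0 d s E : (0 <= hausdorff_content d s E)%E.
Proof.
apply: le_ereal_inf_tmp => _ [U _ <-].
by apply: nneseries_ge0 => k _ _; exact: poweR_ge0.
Qed.

Lemma hausdorff_measure_neq0 s E : hausdorff_measure s E != 0%E ->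
  exists d mu : R, [/\ 0 < d, 0 < mu & (mu%:E <= hausdorff_content d s E)%E].
Proof.
move=> Hn0; apply: contrapT => H; move/negP: Hn0; apply.
rewrite eq_le; apply/andP; split; last first.
  apply: le_trans (hausdorff_content_ge0 1 s E) _.
  by apply: ereal_sup_ubound; exists 1 => //=.
apply: ge_ereal_sup => _ [d /= d0 <-].
rewrite leNgt; apply/negP; case E1 : (hausdorff_content d s E) => [m| |] //.
  by rewrite lte_fin => m0; apply: H; exists d, m; split => //; rewrite E1.
by move=> _; apply: H; exists d, 1; split => //; rewrite E1 leey.
Qed.

(** A cover by balls of radius [r] bounds the content by their number times (2r)^s, while the
    content is at least some [mu > 0] for small [r]. *)
Lemma counting_lower s E : 0 <= s -> hausdorff_measure s E != 0%E ->
  exists c0 r0 : R, [/\ 0 < c0, 0 < r0 & forall r n, 0 < r <= r0 ->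
    coverable r E n -> c0 * r `^ (- s) <= n].
Proof.
move=> s0 /hausdorff_measure_neq0[d [mu [d0 mu0 Hmu]]].
exists (mu * 2 `^ (- s)), (d / 2); split; rewrite ?divr_gt0//.
  by rewrite mulr_gt0// powR_gt0.
move=> r n /andP[r0 rd] [l ln El].
(* The finite list becomes a sequence by padding with empty sets, which the content skips. *)
pose U k := if (k < size l)%N then ball (nth 0 l k) r else set0.
have r20 : 0 <= 2 * r by lra.
have Ud k : (diam (U k) <= (2 * r)%:E)%E.
  rewrite /U; case: ifP => _; first exact: diam_ball.
  by apply: ge_ereal_sup => x [[y z]] [].
have : (hausdorff_content d s E <= ((size l)%:R * (2 * r) `^ s)%:E)%E.
  apply: le_trans (_ : \sum_(k <oo | U k != set0) diam (U k) `^ s <= _)%E.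
    apply: ereal_inf_lbound; exists U => //; split => [x /El[y /= yl xy]|k].
      exists (index y l) => //; rewrite /U index_mem yl.
      by rewrite nth_index.
    by apply: le_trans (Ud k) _; rewrite lee_fin; lra.
  apply: lime_le.
    by apply: is_cvg_nneseries => k _ _; exact: poweR_ge0.
  apply: nearW => m.
  suff H : (\sum_(0 <= k < m | U k != set0) diam (U k) `^ s <=
      ((minn m (size l))%:R * (2 * r) `^ s)%:E)%E.
    apply: le_trans H _; rewrite lee_fin ler_wpM2r ?powR_ge0//.
    by rewrite ler_nat geq_minr.
  elim: m => [|m IH]; first by rewrite big_geq// min0n mul0r.
  rewrite big_mkcond big_nat_recr//= -big_mkcond/=.
  have [ml|lm] := ltnP m (size l); last first.
    have -> : U m = set0 by rewrite /U ltnNge lm.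
    rewrite eqxx /= adde0; apply: le_trans IH _.
    by rewrite !(minn_idPr _)// ltnW.
  move: IH; rewrite (minn_idPl (ltnW ml)) (minn_idPl ml) => IH.
  have -> : (m.+1%:R * (2 * r) `^ s)%:E =
      ((m%:R * (2 * r) `^ s)%:E + ((2 * r) `^ s)%:E)%E.
    by rewrite -EFinD -natr1; congr (_ %:E); ring.
  apply: leeD IH _; case: ifPn => [/set0P[x Ux]|_]; last first.
    by rewrite lee_fin powR_ge0.
  have Ux0 : (0 <= diam (U m))%E.
    by apply: le_trans (diam_ub Ux Ux); rewrite lee_fin.
  rewrite -poweR_EFin; apply: (gt0_ler_poweR s0); last exact: Ud.
    by rewrite in_itv/= leey andbT.
  by rewrite in_itv/= leey andbT lee_fin.
move=> /(le_trans Hmu); rewrite lee_fin powRM ?(ltW r0)// => H.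
apply: le_trans ln.
have p2 : 0 < 2 `^ s * r `^ s :> R by rewrite mulr_gt0 ?powR_gt0.
by rewrite !powRN -mulrA -invfM ler_pdivrMr.
Qed.

Lemma sum_halves m : \sum_(0 <= k < m) (2^-1 : R) ^+ k.+1 <= 1.
Proof.
suff -> : \sum_(0 <= k < m) (2^-1 : R) ^+ k.+1 = 1 - 2^-1 ^+ m.
  by rewrite lerBlDr lerDl exprn_ge0.
elim: m => [|m IH]; first by rewrite big_geq// expr0 subrr.
by rewrite big_nat_recr//= IH exprS; field.
Qed.

(** Real weights replace powers of extended diameters. The geometric summand makes every weight
    positive, even that of a single point; the descent below ends by contradicting this
    positivity. *)
Lemma small_weighted_cover s E e : 0 <= s -> 0 < e -> hausdorff_measure s E = 0%E ->
  exists (U : nat -> set R) (w : nat -> R),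
    [/\ E `<=` \bigcup_k U k, forall k, 0 < w k,
        forall k x y, U k x -> U k y -> `|x - y| `^ s <= w k &
        forall m, \sum_(0 <= k < m) w k <= e].
Proof.
move=> s0 e0 HE; have e2 : 0 < e / 2 by rewrite divr_gt0.
have : (hausdorff_content 1 s E < (e / 2)%:E)%E.
  apply: le_lt_trans (_ : (0 < _)%E); last by rewrite lte_fin.
  by rewrite -HE; apply: ereal_sup_ubound; exists 1 => //=.
move=> /ereal_inf_lt[_ [U [EU Ud] <-]] Ue.
pose v k := if U k == set0 then 0 else fine (diam (U k)) `^ s.
have v0 k : 0 <= v k by rewrite /v; case: ifP => // _; exact: powR_ge0.
have Uf k : U k != set0 -> (fine (diam (U k)))%:E = diam (U k).
  move=> /set0P[x Ux]; rewrite fineK// ge0_fin_numE.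
    by apply: le_lt_trans (Ud k) _; exact: ltry.
  by apply: le_trans (diam_ub Ux Ux); rewrite lee_fin.
exists U, (fun k => v k + e / 2 * 2^-1 ^+ k.+1); split => //.
- by move=> k; rewrite ltr_wpDl// mulr_gt0// exprn_gt0.
- move=> k x y Ux Uy; have Uk0 : U k != set0 by apply/set0P; exists x.
  apply: le_trans (_ : v k <= _); last by rewrite lerDl mulr_ge0 ?exprn_ge0// ltW.
  rewrite /v (negbTE Uk0) le_powRl// -lee_fin Uf//.
  exact: diam_ub.
- move=> m; rewrite big_split/= -mulr_sumr.
  have := ler_wpM2l (ltW e2) (sum_halves m).
  suff : \sum_(0 <= k < m) v k <= e / 2 by lra.
  rewrite -lee_fin; apply: le_trans (ltW Ue).
  apply: le_trans (nneseries_lim_ge m _); last by move=> k _ _; exact: poweR_ge0.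
  rewrite -sumEFin [leRHS]big_mkcond/=; apply: lee_sum => k _.
  rewrite /v; case: ifPn => //= Uk0.
  by rewrite -poweR_EFin Uf.
Qed.

End HausdorffContent.

(** * The limit set and its coding by words *)

Section LimitSet.
Variables (R : realType) (p : R) (c : nat -> R) (S : nat -> R -> R).
Implicit Types (x y r : R) (i j k m n : nat) (w : nat -> nat).
Hypothesis p_gt0 : 0 < p.
Hypothesis c_bounds : forall i : nat, (2 <= i)%N ->
  0 < c i < i.-1%:R `^ (- p) - i%:R `^ (- p).

Local Notation q i := (i%:R `^ (- p)).
Hypothesis S_affine : forall i x, (2 <= i)%N -> 0 <= x <= 1 -> S i x = c i * x + q i.
Local Notation F := (limit_set [set i : nat | (2 <= i)%N] S).
Local Notation kappa := (end_gap p c).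

Lemma piece_end_le i : (2 <= i)%N -> q i + c i <= 1 - kappa.
Proof.
move=> i2; have /andP[c0 ci] := c_bounds i2.
move: i2; rewrite leq_eqVlt => /predU1P[<-|i3]; first by rewrite /end_gap; lra.
have := left_end_anti p_gt0 (ltn0Sn 1) (leq_pred_lt i3).
have := ratio_gt0 c_bounds (leqnn 2); rewrite /end_gap; lra.
Qed.

Lemma kappa_gt0 : 0 < kappa.
Proof. exact: end_gap_gt0. Qed.

Lemma S_itv i x : (2 <= i)%N -> 0 <= x <= 1 -> 0 <= S i x <= 1.
Proof.
move=> i2 /[dup] x01 /andP[x0 x1]; rewrite S_affine//.
have c0 := ratio_gt0 c_bounds i2; have q0 := powR_ge0 i%:R (- p).
have := piece_end_le i2; have := kappa_gt0.
have := ler_wpM2l (ltW c0) x1; have := mulr_ge0 (ltW c0) x0; lra.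
Qed.

(** A pair (a, r) stands for the affine map y |-> a + r y onto a cylinder interval; [next] composes
    it with one more first-level map. *)
Definition next (st : R * R) i : R * R := (st.1 + st.2 * q i, st.2 * c i).

Fixpoint address w n : R * R :=
  if n is m.+1 then next (address w m) (w m) else (0, 1).

Lemma word_map_address w n x : (forall k, (2 <= w k)%N) -> 0 <= x <= 1 ->
  word_map S w n x = (address w n).1 + (address w n).2 * x.
Proof.
move=> w2; elim: n x => [|n IH] x x01 /=; first by rewrite mul1r add0r.
by rewrite IH ?S_itv// S_affine//; ring.
Qed.

Lemma address_gt0 w n : (forall k, (2 <= w k)%N) -> 0 < (address w n).2.
Proof. by move=> w2; elim: n => //= n IH; rewrite mulr_gt0// (ratio_gt0 c_bounds). Qed.

(** The cylinder intervals cut at the fraction [1 - kappa] are still nested, because every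
    first-level interval ends by [1 - kappa]. The supremum of the left ends lies in all of them. *)
Lemma nested_point w : (forall k, (2 <= w k)%N) ->
  exists2 x, F x & forall n, exists2 y, 0 <= y <= 1 - kappa &
    x = (address w n).1 + (address w n).2 * y.
Proof.
move=> w2; pose a n := (address w n).1; pose r n := (address w n).2.
have r0 n : 0 < r n by exact: address_gt0.
have a_le n : a n <= a n.+1.
  by rewrite lerDl mulr_ge0 ?powR_ge0// ltW// r0.
pose b n := a n + r n * (1 - kappa).
have b_ge n : b n.+1 <= b n.
  rewrite /b (_ : a n.+1 = a n + r n * q (w n))// (_ : r n.+1 = r n * c (w n))//.
  rewrite -addrA lerD2l -mulrA -mulrDr (ler_pM2l (r0 n)).
  apply: le_trans (piece_end_le (w2 n)); rewrite lerD2l.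
  rewrite ler_piMr ?(ltW (ratio_gt0 c_bounds (w2 n)))//.
  by have := kappa_gt0; lra.
have k1 : 0 <= 1 - kappa.
  have := ratio_gt0 c_bounds (leqnn 2); have := powR_ge0 (2 : R) (- p).
  by rewrite /end_gap; lra.
have ab k : a k <= b k.
  by rewrite lerDl mulr_ge0 ?(ltW (r0 k)).
have a_homo : forall m n, (m <= n)%N -> a m <= a n.
  by move=> m n mn; exact: (homo_leq (@lexx _ _) (@le_trans _ _) a_le mn).
have b_homo : forall m n, (m <= n)%N -> b n <= b m.
  move=> m n mn; apply: (@homo_leq _ b (fun u v => v <= u)) mn => //.
  by move=> y x z xy yz; exact: le_trans xy.
have ab' : forall m n, a m <= b n.
  move=> m n; have [mn|nm] := leqP m n; first exact: le_trans (a_homo m n mn) (ab n).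
  exact: le_trans (ab m) (b_homo n m (ltnW nm)).
have ne : range a !=set0 by exists (a 0%N), 0%N.
have ub n : ubound (range a) (b n) by move=> _ [m _ <-].
have hs : has_sup (range a) by split=> //; exists (b 0%N); exact: ub.
pose x := sup (range a).
have ax n : a n <= x by apply: sup_upper_bound => //; exists n.
have xb n : x <= b n by apply: ge_sup => //; exact: ub.
have xn n : exists2 y, 0 <= y <= 1 - kappa & x = a n + r n * y.
  exists ((x - a n) / r n); last by rewrite mulrC divfK ?gt_eqF// subrKC.
  rewrite divr_ge0 ?subr_ge0 ?(ltW (r0 n))//= ler_pdivrMr//.
  by have := xb n; rewrite /b; lra.
exists x => //; exists w => // n _.
have [y /andP[y0 yk] ->] := xn n; have y01 : 0 <= y <= 1.
  by have := kappa_gt0; lra.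
by exists y; rewrite ?word_map_address//= in_itv.
Qed.

Lemma limit_set_inhabited : F !=set0.
Proof. by have [x Fx _] := @nested_point (fun=> 2%N) (fun=> isT); exists x. Qed.

Lemma word_mapS w n : word_map S w n.+1 = S (w 0%N) \o word_map S (w \o succn) n.
Proof. by elim: n => // n IH; rewrite [LHS]/= -/(word_map S w n.+1) IH. Qed.

Lemma word_map_itv w n x : (forall k, (2 <= w k)%N) -> 0 <= x <= 1 ->
  0 <= word_map S w n x <= 1.
Proof. by move=> w2; elim: n x => //= n IH x x01; exact/IH/S_itv. Qed.

Lemma limit_set01 x : F x -> 0 <= x <= 1.
Proof.
move=> [w w2 /(_ 1%N isT)[y /=]]; rewrite in_itv/= => y01 <-.
exact: S_itv (w2 0%N) y01.
Qed.

Lemma limit_set_pieces x : F x -> exists2 i : nat, (2 <= i)%N & piece p c F i x.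
Proof.
move=> [w w2' wx]; have w2 : forall k, (2 <= w k)%N := w2'; exists (w 0%N) => //; have c0 := ratio_gt0 c_bounds (w2 0%N).
have shift n : exists2 z, 0 <= z <= 1 & x = c (w 0%N) * word_map S (w \o succn) n z + q (w 0%N).
  have := wx n.+1 isT; rewrite word_mapS => -[z /= + <-]; rewrite in_itv/= => z01.
  exists z => //; rewrite [LHS]S_affine//; exact: (@word_map_itv (w \o succn) n z (fun k => w2 k.+1)).
exists ((x - q (w 0%N)) / c (w 0%N)); last by rewrite mulrC divfK ?gt_eqF// subrK.
exists (w \o succn) => [k|n _]; first exact: w2.
have [z z01 ->] := shift n; exists z; first by rewrite /= in_itv.
by rewrite addrK mulrC mulKf// gt_eqF.
Qed.

Lemma pieces_limit_set i : (2 <= i)%N -> piece p c F i `<=` F.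
Proof.
move=> i2 _ [y [w w2' wy] <-]; have w2 : forall k, (2 <= w k)%N := w2'.
pose w' k := if k is k'.+1 then w k' else i.
exists w' => [[|k]|[|n] n0] //; first exact: w2.
have Fy : F y by exists w.
rewrite word_mapS (_ : w' \o succn = w)//.
(* The intersection defining [F] starts at level 1, so level 1 of the longer word is served by [y]
   itself, which lies in [[0, 1]]. *)
case: n {n0} => [|n].
  by exists y; rewrite /= ?in_itv/= ?S_affine// limit_set01.
have [z + <-] := wy n.+1 isT; rewrite /= in_itv/= => z01.
exists z; first by rewrite /= in_itv.
by rewrite [LHS]S_affine//; exact: (@word_map_itv w n.+1 z w2).
Qed.

(** A positive bound common to finitely many gaps; since [c j] tends to 0, the pressure argument
    works with finite sums. *)
Lemma gap_exists n : exists2 g : R, 0 < g & forall j, (2 <= j < n)%N -> g <= kappa * c j.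
Proof.
elim: n => [|m [g g0 Hg]]; first by exists 1 => // j; rewrite ltn0 andbF.
have [m2|m2] := leqP 2 m; last first.
  exists g => // j /andP[j2]; rewrite ltnS => jm.
  by have := leq_ltn_trans (leq_trans j2 jm) m2; rewrite ltnn.
exists (Num.min g (kappa * c m)).
  by rewrite lt_min g0 mulr_gt0 ?kappa_gt0// (ratio_gt0 c_bounds).
move=> j /andP[j2]; rewrite ltnS leq_eqVlt => /predU1P[->|jm].
  by rewrite ge_min lexx orbT.
by rewrite ge_min Hg// j2.
Qed.

(** * Descent into light cylinders *)

Section MassDistribution.
Variables (u : R) (n : nat).
Hypothesis u_gt0 : 0 < u.
Hypothesis sum_gt1 : 1 < \sum_(2 <= i < n) c i `^ u.

Variables (U : nat -> set R) (wt : nat -> R) (g W : R).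
Hypothesis g_gt0 : 0 < g.
Hypothesis g_le : forall j, (2 <= j < n)%N -> g <= kappa * c j.
Hypothesis wt_gt0 : forall k, 0 < wt k.
Hypothesis wt_diam : forall k x y, U k x -> U k y -> `|x - y| `^ u <= wt k.
Hypothesis W_gt0 : 0 < W.
Hypothesis W_lt : W < g `^ u.

(** The interval is cut at [1 - kappa] as in [nested_point], which leaves a gap, [kappa * c j]
    relative to the parent, after the child of index [j]. *)
Definition hits (st : R * R) k :=
  `[< exists2 y, 0 <= y <= 1 - kappa & U k (st.1 + st.2 * y) >].

(** A cylinder of length [st.2] is entitled to the share W st.2^u of the weight. *)
Definition light (st : R * R) := 0 < st.2 /\
  forall m, \sum_(0 <= k < m | hits st k) wt k <= W * st.2 `^ u.

Lemma hits_next st i k : (2 <= i)%N -> 0 < st.2 -> hits (next st i) k -> hits st k.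
Proof.
move=> i2 r0 /asboolP[y /andP[y0 yk] Uy]; apply/asboolP.
have c0 := ratio_gt0 c_bounds i2.
exists (q i + c i * y); last by move: Uy; rewrite /= mulrDr addrA mulrA.
rewrite addr_ge0 ?powR_ge0 ?mulr_ge0 ?(ltW c0)//=.
have := piece_end_le i2; have y1 : y <= 1 by have := kappa_gt0; lra.
have := ler_wpM2l (ltW c0) y1; lra.
Qed.

(** Such a set would have two points at distance at least [g * st.2], hence by [W_lt] a weight above
    W st.2^u, more than all that the light parent receives. *)
Lemma hits_unique st i j k : light st -> (2 <= i)%N -> (i < j)%N -> (j < n)%N ->
  hits (next st i) k -> hits (next st j) k -> False.
Proof.
move=> [r0 lst] i2 ij jn hi hj; have j2 := leq_trans i2 (ltnW ij).
have hk := hits_next i2 r0 hi.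
have wk : wt k <= W * st.2 `^ u.
  apply: le_trans (lst k.+1); rewrite big_mkcond big_nat_recr//= hk lerDr.
  by apply: sumr_ge0 => l _; case: ifP => // _; exact: ltW.
have /asboolP[y /andP[y0 yk] Uy] := hi; have /asboolP[z /andP[z0 zk] Uz] := hj.
have := wt_diam Uy Uz; apply/negP; rewrite -ltNge.
apply: le_lt_trans wk _; apply: lt_le_trans (_ : g `^ u * st.2 `^ u <= _).
  by rewrite ltr_pM2r// powR_gt0.
rewrite -powRM ?(ltW g_gt0) ?(ltW r0)// le_powRl ?mulr_ge0 ?(ltW g_gt0) ?(ltW r0) ?(ltW u_gt0)//.
apply: le_trans (ler_norm _); rewrite /next /=.
have -> : st.1 + st.2 * q i + st.2 * c i * y - (st.1 + st.2 * q j + st.2 * c j * z) =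
  (q i + c i * y - q j - c j * z) * st.2 by ring.
rewrite ler_pM2r//.
have ci := ratio_gt0 c_bounds i2; have cj := ratio_gt0 c_bounds j2.
have := left_end_anti p_gt0 (ltnW i2) (leq_pred_lt ij).
have /andP[_] := c_bounds j2.
have := mulr_ge0 (ltW ci) y0; have := ler_wpM2l (ltW cj) zk.
have : g <= kappa * c j by apply: g_le; rewrite j2.
lra.
Qed.

(* If every child were heavy, the children's total weight would exceed the
   parent's, although the sets of weight at most that of the parent are too
   small to meet two children. *)
Lemma light_next st : light st -> exists2 i, (2 <= i < n)%N & light (next st i).
Proof.
move=> /[dup] lst [r0 hst]; apply: contrapT => H.
have heavy i : exists m, (2 <= i < n)%N ->
    W * (st.2 * c i) `^ u < \sum_(0 <= k < m | hits (next st i) k) wt k.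
  have [/andP[i2 iN]|] := boolP (2 <= i < n)%N; last by exists 0%N.
  apply: contrapT => Hm; apply: H; exists i; first by rewrite i2.
  split; first by rewrite mulr_gt0// (ratio_gt0 c_bounds).
  by move=> m; rewrite leNgt; apply/negP => h; apply: Hm; exists m.
have /choice[M HM] := heavy.
(* A common truncation level at which every child is already seen to be heavy. *)
pose m := (\max_(i < n) M i)%N.
have le_m i : (i < n)%N -> (M i <= m)%N.
  by move=> iN; rewrite (leq_trans _ (leq_bigmax (Ordinal iN))).
have := hst m; apply/negP; rewrite -ltNge.
apply: lt_le_trans (_ : W * st.2 `^ u * \sum_(2 <= i < n) c i `^ u <= _).
  by rewrite ltr_pMr// mulr_gt0// powR_gt0.
apply: le_trans (_ : \sum_(2 <= i < n) \sum_(0 <= k < m | hits (next st i) k) wt k <= _).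
  rewrite mulr_sumr [leLHS]big_nat_cond [leRHS]big_nat_cond.
  apply: ler_sum => i; rewrite andbT => iN.
  rewrite -mulrA -powRM ?(ltW r0)//; last by rewrite ltW// (ratio_gt0 c_bounds)//; case/andP: iN.
  apply: le_trans (ltW (HM i iN)) _.
  rewrite [leRHS](@big_cat_nat _ _ _ (M i))//=; last by apply: le_m; case/andP: iN.
  by rewrite lerDl sumr_ge0// => k _; exact: ltW.
(* After exchanging the sums, each set is counted for at most one child. *)
under eq_bigr do rewrite big_mkcond.
rewrite exchange_big/= [leRHS]big_mkcond/=; apply: ler_sum => k _.
rewrite -big_mkcond/=.
have [[i /andP[/andP[i2 iN] hi]]|no] :=
  pselect (exists i, (2 <= i < n)%N && hits (next st i) k).
  rewrite (hits_next i2 r0 hi) (@big_nat_widenl _ _ _ 2 0)// big_mkord/=.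
  rewrite (big_pred1 (Ordinal iN))// => j /=.
  apply/andP/eqP => [[hj j2]|->]; last by rewrite /= hi i2.
  apply/val_inj => /=; case: (ltngtP j i) => // [ji|ij].
    by case: (hits_unique lst j2 ji iN hj hi).
  by case: (hits_unique lst i2 ij (ltn_ord j) hi hj).
rewrite big_nat_cond big_pred0; first by case: ifP => // _; exact: ltW.
by move=> i; apply/negbTE/negP => h; apply: no; exists i.
Qed.

Hypothesis U_cover : F `<=` \bigcup_k U k.
Hypothesis wt_sum : forall m, \sum_(0 <= k < m) wt k <= W.

(** The limit point [x] of the descent lies in some [U k], which hits every cylinder on the way;
    their shares tend to 0 and fall below [wt k]. *)
Lemma light_cover_absurd : False.
Proof.
have st0 : light (0, 1).
  split=> //= m; rewrite powR1 mulr1; apply: le_trans (wt_sum m).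
  by rewrite big_mkcond; apply: ler_sum => k _; case: ifP => // _; exact: ltW.
(* The letter 2 is a default for states that are not light. *)
have /choice[d Hd] : forall st, exists i, (2 <= i)%N /\ (light st -> light (next st i)).
  move=> st; have [/light_next[i /andP[i2 _] li]|nl] := pselect (light st).
    by exists i.
  by exists 2%N; split.
pose st := fix st k := if k is k'.+1 then next (st k') (d (st k')) else (0, 1).
pose w k := d (st k).
have stE k : address w k = st k by elim: k => //= k ->.
have w2 k : (2 <= w k)%N by have [] := Hd (st k).
have lst k : light (address w k).
  by rewrite stE; elim: k => //= k IH; have [_] := Hd (st k); exact.
have [x /U_cover[k _ Ux] Hx] := nested_point w2.
have e0 : 0 < wt k / (2 * W) by rewrite divr_gt0// mulr_gt0.
have [r1 /andP[r10 r11] Hr1] := powR_small u_gt0 e0.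
have [xi /andP[xi0 xi1] cxi] := contraction_bound p_gt0 c_bounds.
have [m hm] : exists m, xi ^+ m <= r1.
  have /cvgr0_norm_le/(_ _ r10) [m _ /(_ m (leqnn m))] :=
    @cvg_expr _ xi ltac:(by rewrite gtr0_norm).
  by rewrite /= ger0_norm ?exprn_ge0 ?(ltW xi0)//; exists m.
have rm : (address w m).2 <= xi ^+ m.
  elim: m {hm} => [|m IH] /=; first by rewrite expr0.
  rewrite exprSr ler_pM ?(ltW (address_gt0 _ _))//; last exact: cxi.
  by rewrite ltW// (ratio_gt0 c_bounds).
have [r0 wm] := lst m.
have hk : hits (address w m) k.
  by have [y yk xy] := Hx m; apply/asboolP; exists y => //; rewrite -xy.
have : wt k <= W * (address w m).2 `^ u.
  apply: le_trans (wm k.+1); rewrite big_mkcond big_nat_recr//= hk lerDr.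
  by apply: sumr_ge0 => l _; case: ifP => // _; exact: ltW.
have /Hr1 : 0 < (address w m).2 <= r1 by rewrite r0 (le_trans rm).
move=> /(ler_wpM2l (ltW W_gt0)).
have -> : W * (wt k / (2 * W)) = wt k / 2 by field; rewrite gt_eqF.
have := wt_gt0 k; lra.
Qed.

End MassDistribution.

Lemma pressure_le1 (u : R) n : 0 < u -> hausdorff_measure u F = 0%E ->
  \sum_(2 <= i < n) c i `^ u <= 1.
Proof.
move=> u0 HF; rewrite leNgt; apply/negP => sum1.
have [g g0 Hg] := gap_exists n.
have W0 : 0 < g `^ u / 2 by rewrite divr_gt0 ?powR_gt0.
have Wg : g `^ u / 2 < g `^ u by rewrite gtr_pMr ?powR_gt0// invf_lt1// ltr1n.
have [U [w [FU w0 wd ws]]] := small_weighted_cover (ltW u0) W0 HF.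
exact: (light_cover_absurd u0 sum1 g0 Hg w0 wd W0 Wg FU ws).
Qed.

End LimitSet.

(** Lower bounds are first obtained with [h - d] in place of [h]; a loss linear in [d] vanishes in
    the limit. *)
Lemma lee_limit_sub (R : realType) (v K d0 : R) (x : \bar R) : 0 < d0 ->
  (forall d, 0 < d < d0 -> ((v - d * K)%:E <= x)%E) -> (v%:E <= x)%E.
Proof.
move=> d00 H; apply/lee_addgt0Pr => e e0.
have K0 : 0 < `|K| + 1 by rewrite ltr_wpDl.
pose d := Num.min (d0 / 2) (e / (`|K| + 1)).
have d_gt0 : 0 < d by rewrite lt_min !divr_gt0.
have dd0 : d < d0.
  apply: le_lt_trans (_ : d0 / 2 < d0); last by lra.
  by rewrite ge_min lexx.
have dK : d * K <= e.
  have : d * (`|K| + 1) <= e by rewrite -ler_pdivlMr// ge_min lexx orbT.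
  by have := ler_wpM2l (ltW d_gt0) (ler_norm K); lra.
rewrite -leeBlDr// -EFinB; apply: le_trans (H d _); last by rewrite d_gt0.
by rewrite lee_fin lerD2l lerN2.
Qed.

(** * Spectrum of the limit set on each range of theta *)

Section Spectrum.
Variables (R : realType) (p t h : R) (S : nat -> R -> R) (c : nat -> R).
Local Notation F := (limit_set [set i : nat | (2 <= i)%N] S).
Local Notation q i := (i%:R `^ (- p)).
Hypothesis p_gt0 : 0 < p.
Hypothesis t_ge : p + 1 <= t.
Hypothesis h_range : (p + 1)^-1 < h < 1.
Hypothesis c_bounds : forall i : nat, (2 <= i)%N ->
  0 < c i < i.-1%:R `^ (- p) - i%:R `^ (- p).
Hypothesis S_affine : forall (i : nat) (x : R), (2 <= i)%N -> 0 <= x <= 1 ->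
  S i x = c i * x + q i.
Variable N : nat.
Hypothesis c_tail : forall i : nat, (N <= i)%N -> (2 <= i)%N ->
  c i = p * i%:R `^ (- t).
Hypothesis F_dim : hausdorff_dim F = h%:E.

Let F01 := limit_set01 p_gt0 c_bounds S_affine.
Let F_pieces := limit_set_pieces p_gt0 c_bounds S_affine.
Let pieces_F := pieces_limit_set p_gt0 c_bounds S_affine.
Let F_inhabited := limit_set_inhabited p_gt0 c_bounds S_affine.

Let h_gt0 : 0 < h.
Proof.
case/andP: h_range => + _; apply: lt_trans.
by rewrite invr_gt0 addr_gt0.
Qed.

(** Some [u] with h <= u < s has measure zero, so the sums at [u] are at most 1; passing from [u] to
    [s] gains the factor xi^(s-u) < 1. *)
Lemma pressure_lt1 (s : R) : h < s -> exists2 k : R, k < 1 &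
  forall n, \sum_(2 <= i < n) c i `^ s <= k.
Proof.
move=> hs; have : (hausdorff_dim F < s%:E)%E by rewrite F_dim lte_fin.
move=> /ereal_inf_lt[_ [u [u0 Fu] <-]]; rewrite lte_fin => us.
have hu : h <= u.
  by rewrite -lee_fin -F_dim; apply: ereal_inf_lbound; exists u.
have u_gt0 : 0 < u by apply: lt_le_trans hu.
have [xi /andP[xi0 xi1] cxi] := contraction_bound p_gt0 c_bounds.
have su0 : 0 < s - u by rewrite subr_gt0.
exists (xi `^ (s - u)).
  have := gt0_ltr_powR su0 (_ : xi \in Num.nneg) (_ : 1 \in Num.nneg) xi1.
  by rewrite powR1; apply; rewrite nnegrE// ltW.
move=> n; have := pressure_le1 p_gt0 c_bounds S_affine n u_gt0 Fu.
move=> /(ler_wpM2l (powR_ge0 xi (s - u))); rewrite mulr1; apply: le_trans.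
rewrite mulr_sumr big_nat_cond [leRHS]big_nat_cond.
apply: ler_sum => i /andP[/andP[i2 _] _]; have ci := ratio_gt0 c_bounds i2.
have -> : c i `^ s = c i `^ (s - u) * c i `^ u by rewrite -powRDp// subrK.
rewrite ler_wpM2r ?powR_ge0//.
by rewrite le_powRl ?cxi// ltW.
Qed.

Lemma counting_lower_lt (s : R) : 0 <= s -> s < h ->
  exists c0 r0 : R, [/\ 0 < c0, 0 < r0 & forall r (n : R), 0 < r <= r0 ->
    coverable r F n -> c0 * r `^ (- s) <= n].
Proof.
move=> s0 sh; apply: counting_lower => //; apply/eqP => Fs.
have : (h%:E <= s%:E)%E by rewrite -F_dim; apply: ereal_inf_lbound; exists s.
by rewrite lee_fin leNgt sh.
Qed.

Lemma ratio_upper : exists2 Ct : R, 1 <= Ct &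
  forall i : nat, (2 <= i)%N -> c i <= Ct * i%:R `^ (- t).
Proof.
have [Ct Ct1 HCt] : exists2 Ct : R, 1 <= Ct &
    forall i : nat, (2 <= i < N)%N -> c i <= Ct * i%:R `^ (- t).
  elim: N => [|m [Ct Ct1 IH]]; first by exists 1 => // i; rewrite ltn0 andbF.
  exists (Num.max Ct (c m * m%:R `^ t)); first by rewrite le_max Ct1.
  move=> i /andP[i2]; rewrite ltnS leq_eqVlt => /predU1P[im|im].
    rewrite -im; apply: le_trans (_ : c i * i%:R `^ t * i%:R `^ (- t) <= _).
      by rewrite -mulrA -powRDp ?ltr0n ?(ltnW i2)// subrr powRr0 mulr1.
    by rewrite ler_wpM2r ?powR_ge0// le_max lexx orbT.
  apply: le_trans (IH i _) _; first by rewrite i2.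
  by rewrite ler_wpM2r ?powR_ge0// le_max lexx.
exists (Ct + p); first by have := p_gt0; lra.
move=> i i2; have [Ni|iN] := leqP N i.
  rewrite c_tail// ler_wpM2r ?powR_ge0//; lra.
apply: le_trans (HCt i _) _; first by rewrite i2.
by rewrite ler_wpM2r ?powR_ge0//; have := p_gt0; lra.
Qed.

Let ip1_lt_h : (1 + p)^-1 < h.
Proof. by rewrite addrC; case/andP: h_range. Qed.

Lemma box_gt (s : R) : h < s -> exists2 A : R, 1 <= A &
  forall r, 0 < r -> coverable r F (A * (1 + r `^ (- s))).
Proof.
move=> hs; have [k k1 Hk] := pressure_lt1 hs.
apply: (box_counting p_gt0 c_bounds F01 F_pieces pieces_F _ k1 Hk).
by apply: ltW; apply: lt_trans hs.
Qed.

Lemma upper_box_dimE : upper_box_dim F = h%:E.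
Proof.
apply/eqP; rewrite eq_le; apply/andP; split.
  apply/lee_addgt0Pr => e e0.
  have [|A A1 HA] := @box_gt (h + e / 2); first by lra.
  rewrite -EFinD (_ : h + e = h + e / 2 + e / 2); last by field.
  apply: (upper_box_dim_le _ A1 HA); last by rewrite divr_gt0.
  by have := h_gt0; lra.
apply: (@lee_limit_sub _ _ 2 h _ h_gt0) => d /andP[d0 dh].
have [||c0 [r0 [c00 r00 H]]] := @counting_lower_lt (h - d); [lra|lra|].
rewrite (_ : h - d * 2 = h - d - d); last by ring.
exact: (upper_box_dim_ge c00 r00 H).
Qed.

Local Notation sp theta := (assouad_spectrum_interior theta F).

Lemma ht_gt1 : 0 < h * t - 1.
Proof.
have p0 := p_gt0; have h0 := h_gt0; have tp := t_ge; have /andP[hp _] := h_range.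
have : (p + 1)^-1 * (p + 1) < h * (p + 1) by rewrite ltr_pM2r//; lra.
by rewrite mulVf ?gt_eqF//; [have := ler_wpM2l (ltW h0) tp; lra | lra].
Qed.

(** The three inequalities say that [v] dominates the three competing counts at the exponent [h];
    the window bound is applied at [h + d], and [e] absorbs the difference. *)
Lemma spectrum_upper (theta v : R) : 0 < theta < 1 ->
  (1 + p)^-1 / theta <= v * (theta^-1 - 1) -> h <= v ->
  h / theta - (t * h - 1) / p <= v * (theta^-1 - 1) ->
  (sp theta <= v%:E)%E.
Proof.
move=> /[dup] th01 /andP[th0 th1] a1 a2 a3; apply/lee_addgt0Pr => e e0.
have [h0 h1] := (h_gt0, andP h_range); case: h1 => _ h1.
have p0 := p_gt0; have tp := t_ge.
(* The first bound gives d / theta <= e (1 / theta - 1), the second keeps [h + d < 1]. *)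
pose d := Num.min (e * (1 - theta)) ((1 - h) / 2).
have d0 : 0 < d by rewrite lt_min divr_gt0 ?subr_gt0// mulr_gt0// subr_gt0.
have de : d <= e * (1 - theta) by rewrite ge_min lexx.
have d1 : d <= (1 - h) / 2 by rewrite ge_min lexx orbT.
have hs : h < h + d by lra.
have s01 : 0 < h + d < 1 by apply/andP; split; lra.
have ts1 : 1 < t * (h + d).
  by have := ht_gt1; have : 0 <= t * d by [apply: mulr_ge0; lra|]; lra.
have [A A1 HA] := box_gt hs; have [Ct Ct1 HCt] := ratio_upper.
have [C C1 HC] := coverable_window p_gt0 c_bounds F01 F_pieces s01 ts1 A1 HA Ct1 HCt.
have C0 : 0 < C by lra.
have th' : 0 < theta^-1 - 1 by rewrite subr_gt0 invf_gt1.
rewrite -EFinD; apply: (spectrum_le_window th01 C0 HC).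
- by have : 0 <= e * (theta^-1 - 1) by [rewrite mulr_ge0// ltW|]; lra.
- rewrite ler_wpM2r ?(ltW th')//.
  have : e * (1 - theta) <= e by rewrite ler_piMr ?(ltW e0)//; lra.
  lra.
- have : d / theta <= e * (theta^-1 - 1).
    rewrite ler_pdivrMr// -mulrA mulrBl mulVf ?mul1r// gt_eqF//.
  have : 0 <= t * d / p by rewrite !mulr_ge0 ?invr_ge0//; lra.
  lra.
Qed.

Lemma spectrum_ge_points (theta : R) : 0 < theta < p / (1 + p) ->
  ((((1 + p)^-1 / theta) / (theta^-1 - 1))%:E <= sp theta)%E.
Proof.
move=> thp; apply: spectrum_lowerP.
  have := p_gt0; case/andP: thp => -> /lt_trans/= + p0; apply.
  by rewrite ltr_pdivrMr; lra.
exact: (spectrum_lower_points p_gt0 c_bounds F01 pieces_F F_inhabited thp).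
Qed.

Lemma spectrum_ge_dim (theta : R) : 0 < theta < 1 -> (h%:E <= sp theta)%E.
Proof.
move=> /[dup] th01 /andP[th0 th1]; apply: (@lee_limit_sub _ _ 1 h _ h_gt0) => d /andP[d0 dh].
have [||c0 [r0 [c00 r00 H]]] := @counting_lower_lt (h - d); [lra|lra|].
have th' : 0 < theta^-1 - 1 by rewrite subr_gt0 invf_gt1.
have hd : 0 <= h - d by lra.
have := spectrum_lowerP th01
  (spectrum_lower_dim p_gt0 c_bounds F01 F_pieces pieces_F F_inhabited hd c00 r00 H th01).
by rewrite mulfK ?gt_eqF// mulr1.
Qed.

Lemma spectrum_ge_pieces (theta : R) : 0 < theta < p / t -> theta < 1 ->
  (((h / theta - (t * h - 1) / p) / (theta^-1 - 1))%:E <= sp theta)%E.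
Proof.
move=> /[dup] thp /andP[th0 _] th1; have th01 : 0 < theta < 1 by rewrite th0.
(* The bound is affine in the exponent, with slope [K]. *)
pose K := (theta^-1 - t / p) / (theta^-1 - 1).
apply: (@lee_limit_sub _ _ K h _ h_gt0) => d /andP[d0 dh].
have [||c0 [r0 [c00 r00 H]]] := @counting_lower_lt (h - d); [lra|lra|].
have hd : 0 <= h - d by lra.
have := spectrum_lowerP th01
  (spectrum_lower_pieces p_gt0 t_ge c_bounds F01 pieces_F F_inhabited hd c00 r00 H thp c_tail).
apply: le_trans; rewrite lee_fin le_eqVlt; apply/orP; left; apply/eqP.
by rewrite /K; ring.
Qed.

Lemma spectrum_interior_full (theta : R) : p / (1 + p) <= theta < 1 -> sp theta = 1%:E.
Proof.
move=> /[dup] thp /andP[pth th1].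
have p0 := p_gt0.
have th01 : 0 < theta < 1.
  by rewrite th1 andbT; apply: lt_le_trans pth; rewrite divr_gt0//; lra.
apply/eqP; rewrite eq_le spectrum_le1//=.
have := spectrum_lowerP th01
  (spectrum_lower_full p_gt0 c_bounds F01 pieces_F F_inhabited thp).
by rewrite divff// gt_eqF// subr_gt0 invf_gt1//; case/andP: th01.
Qed.

Lemma quasi_assouad_dimE : quasi_assouad_dim F = 1%:E.
Proof.
have p0 := p_gt0; apply: cvg_lim => //; apply: cvg_near_cst; near=> theta.
apply: spectrum_interior_full; apply/andP; split; near: theta.
  by apply: nbhs_left_ge; rewrite ltr_pdivrMr; lra.
exact: nbhs_left_lt.
Unshelve. all: by end_near. Qed.

Lemma assouad_spectrum_full (theta : R) : p / (1 + p) <= theta <= 1 ->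
  assouad_spectrum theta F = 1%:E.
Proof.
move=> /andP[pth th1]; have p0 := p_gt0.
have th0 : 0 < theta by apply: lt_le_trans pth; rewrite divr_gt0//; lra.
rewrite /assouad_spectrum gt_eqF//; case: eqVneq => [_|thn1].
  exact: quasi_assouad_dimE.
by apply: spectrum_interior_full; rewrite pth lt_neqAle thn1.
Qed.

Lemma assouad_spectrum_interiorE (theta : R) : 0 < theta < 1 ->
  assouad_spectrum theta F = sp theta.
Proof. by move=> /andP[th0 th1]; rewrite /assouad_spectrum gt_eqF// lt_eqF. Qed.

Lemma assouad_spectrum0 : assouad_spectrum 0 F = h%:E.
Proof. by rewrite /assouad_spectrum eqxx upper_box_dimE. Qed.

(** [theta < p / t] permits counting whole pieces. The upper bound on [theta] says that this count
    dominates one point per piece, and [h * (t - p) <= 1] that it dominates [h]. *)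
Lemma assouad_spectrum_pieces (theta : R) : h * (t - p) <= 1 ->
  theta < p / t ->
  0 <= theta <= (h + h * p - 1) * p / ((1 + p) * (h * t - 1)) ->
  assouad_spectrum theta F
    = (h + theta / (p * (1 - theta)) * (1 - h * (t - p)))%:E.
Proof.
have [[p0 h0] [tp ht1]] := ((p_gt0, h_gt0), (t_ge, ht_gt1)).
move=> htp thpt /andP[th0 thle].
have [->|thn0] := eqVneq theta 0.
  by rewrite assouad_spectrum0 mul0r mul0r addr0.
have {}th0 : 0 < theta by rewrite lt_neqAle eq_sym thn0.
have th1 : theta < 1.
  by apply: lt_trans thpt _; rewrite ltr_pdivrMr; lra.
have th01 : 0 < theta < 1 by rewrite th0.
rewrite assouad_spectrum_interiorE//.
set v := h + _.
have vE : v * (theta^-1 - 1) = h / theta - (t * h - 1) / p.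
  by rewrite /v; field; rewrite ?gt_eqF// subr_gt0.
have th' : 0 < theta^-1 - 1 by rewrite subr_gt0 invf_gt1.
apply/eqP; rewrite eq_le; apply/andP; split; last first.
  have := @spectrum_ge_pieces theta; rewrite -vE mulfK ?gt_eqF//; apply => //.
  by rewrite th0.
apply: spectrum_upper => //; last by rewrite vE.
- rewrite vE ler_pdivrMr// mulrBl divfK ?gt_eqF//.
  move: thle; rewrite ler_pdivlMr ?mulr_gt0//; last by lra.
  move=> thle; rewrite -div1r ler_pdivrMr; last by lra.
  have -> : (h - (t * h - 1) / p * theta) * (1 + p) =
     1 + ((h + h * p - 1) * p - theta * ((1 + p) * (h * t - 1))) / p.
    by field; rewrite gt_eqF.
  by rewrite lerDl divr_ge0 ?(ltW p0)// subr_ge0.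
- rewrite lerDl mulr_ge0//; last by lra.
  by rewrite divr_ge0 ?mulr_ge0//; lra.
Qed.

(** The last two inequalities say that one point per piece dominates [h] and the count of whole
    pieces, respectively. *)
Lemma assouad_spectrum_middle (theta : R) : 0 < theta < p / (1 + p) ->
  h * (1 + p) * (1 - theta) <= 1 ->
  (h + h * p - 1) * p <= theta * ((1 + p) * (h * t - 1)) ->
  assouad_spectrum theta F = (((1 + p) * (1 - theta))^-1)%:E.
Proof.
have [[p0 h0] [tp ht1]] := ((p_gt0, h_gt0), (t_ge, ht_gt1)).
move=> /[dup] thp /andP[th0 th_lt] a2 a3.
have th1 : theta < 1.
  by apply: lt_trans th_lt _; rewrite ltr_pdivrMr; lra.
have th01 : 0 < theta < 1 by rewrite th0.
rewrite assouad_spectrum_interiorE//.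
set v := _^-1.
have vE : v * (theta^-1 - 1) = (1 + p)^-1 / theta.
  by rewrite /v; field; rewrite ?gt_eqF//; lra.
have th' : 0 < theta^-1 - 1 by rewrite subr_gt0 invf_gt1.
apply/eqP; rewrite eq_le; apply/andP; split; last first.
  by have := spectrum_ge_points thp; rewrite -vE mulfK ?gt_eqF.
apply: spectrum_upper => //; first by rewrite vE.
- rewrite /v -div1r ler_pdivlMr ?mulr_gt0//; lra.
- rewrite vE ler_pdivlMr// mulrBl divfK ?gt_eqF//.
  rewrite -[leRHS]div1r ler_pdivlMr; last by lra.
  have -> : (h - (t * h - 1) / p * theta) * (1 + p) =
     1 + ((h + h * p - 1) * p - theta * ((1 + p) * (h * t - 1))) / p.
    by field; rewrite gt_eqF.
  by rewrite gerDl pmulr_lle0 ?invr_gt0// subr_le0.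
Qed.

(** [1 <= h * (t - p)] makes the exponent of whole pieces at most [h], and the bound on [theta] does
    the same for one point per piece. *)
Lemma assouad_spectrum_dim (theta : R) : 1 <= h * (t - p) ->
  0 <= theta <= (h + h * p - 1) / (h * (1 + p)) ->
  assouad_spectrum theta F = h%:E.
Proof.
have [[p0 h0] [tp ht1]] := ((p_gt0, h_gt0), (t_ge, ht_gt1)).
move=> htp /andP[th0]; rewrite ler_pdivlMr; last by rewrite mulr_gt0//; lra.
move=> thle; have [->|thn0] := eqVneq theta 0; first exact: assouad_spectrum0.
have {}th0 : 0 < theta by rewrite lt_neqAle eq_sym thn0.
have hp0 : 0 < h * (1 + p) by rewrite mulr_gt0//; lra.
have th1 : theta < 1.
  by rewrite -(ltr_pM2r hp0); lra.
have th01 : 0 < theta < 1 by rewrite th0.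
rewrite assouad_spectrum_interiorE//.
apply/eqP; rewrite eq_le spectrum_ge_dim// andbT.
have hE : h * (theta^-1 - 1) = h / theta - h by ring.
apply: spectrum_upper => //; rewrite hE.
  rewrite ler_pdivrMr// mulrBl divfK ?gt_eqF// -[leLHS]div1r ler_pdivrMr; last by lra.
  by lra.
by rewrite lerD2l lerN2 ler_pdivlMr//; lra.
Qed.

End Spectrum.

(** * The three regimes of t *)

Theorem theorem5p1 (R : realType) (p t h : R) (S : nat -> R -> R) (c : nat -> R)
  (I := [set i : nat | (2 <= i)%N])
  (F := limit_set I S)
  (p_gt0 : 0 < p)
  (t_ge : p + 1 <= t)
  (h_range : (p + 1)^-1 < h < 1)
  (S_cifs : similarity_cifs I S)
  (S_def : forall i : nat, (2 <= i)%N ->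
     0 < c i < (i.-1)%:R `^ (- p) - i%:R `^ (- p) /\
     forall x : R, 0 <= x <= 1 -> S i x = c i * x + i%:R `^ (- p))
  (c_tail : exists2 N : nat, (1 <= N)%N &
     forall i : nat, (2 <= i)%N -> (N <= i)%N -> c i = p * i%:R `^ (- t))
  (F_dim : hausdorff_dim F = h%:E) :
  [/\ t = p + 1 ->
        forall theta : R,
          (0 <= theta < p / (1 + p) ->
             assouad_spectrum theta F
               = (h + theta / (p * (1 - theta)) * (1 - h))%:E) /\
          (p / (1 + p) <= theta <= 1 -> assouad_spectrum theta F = 1%:E),
      p + 1 < t < p + h^-1 ->
        forall theta : R,
          [/\ 0 <= theta <= (h + h * p - 1) * p / ((1 + p) * (h * t - 1)) ->
                assouad_spectrum theta F
                  = (h + theta / (p * (1 - theta)) * (1 - h * (t - p)))%:E,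
              (h + h * p - 1) * p / ((1 + p) * (h * t - 1)) < theta
                < p / (1 + p) ->
                assouad_spectrum theta F = (((1 + p) * (1 - theta))^-1)%:E &
              p / (1 + p) <= theta <= 1 -> assouad_spectrum theta F = 1%:E] &
      p + h^-1 <= t ->
        forall theta : R,
          [/\ 0 <= theta <= (h + h * p - 1) / (h * (1 + p)) ->
                assouad_spectrum theta F = h%:E,
              (h + h * p - 1) / (h * (1 + p)) < theta < p / (1 + p) ->
                assouad_spectrum theta F = (((1 + p) * (1 - theta))^-1)%:E &
              p / (1 + p) <= theta <= 1 -> assouad_spectrum theta F = 1%:E]].
Proof.
have c_bounds i (i2 : (2 <= i)%N) := (S_def i i2).1.
have S_affine i x (i2 : (2 <= i)%N) := (S_def i i2).2 x.
have [N _ cN] := c_tail.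
have c_tail' i (Ni : (N <= i)%N) (i2 : (2 <= i)%N) := cN i i2 Ni.
have /andP[hp h1] := h_range.
have h0 : 0 < h by apply: lt_trans hp; rewrite invr_gt0 addr_gt0.
have ht1 := ht_gt1 p_gt0 t_ge h_range.
have hp1 : 0 < h + h * p - 1.
  have : (p + 1)^-1 * (p + 1) < h * (p + 1) by rewrite ltr_pM2r//; lra.
  by rewrite mulVf ?gt_eqF//; lra.
have full := assouad_spectrum_full p_gt0 c_bounds S_affine.
have middle := assouad_spectrum_middle p_gt0 t_ge h_range c_bounds S_affine c_tail' F_dim.
have pieces := assouad_spectrum_pieces p_gt0 t_ge h_range c_bounds S_affine c_tail' F_dim.
split.
- move=> tE theta; split; last exact: full.
  move=> /andP[th0 thp].
  have hE : h * (t - p) = h by rewrite tE; ring.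
  have := pieces theta; rewrite hE; apply; first exact: ltW.
    by rewrite tE addrC.
  (* For t = p + 1 the two thresholds coincide and the middle range is empty. *)
  have -> : (h + h * p - 1) * p / ((1 + p) * (h * t - 1)) = p / (1 + p).
    by rewrite tE; field; rewrite !gt_eqF//; lra.
  by rewrite th0 ltW.
- move=> /andP[pt tph] theta.
  have htp : h * (t - p) < 1 by rewrite mulrC -ltr_pdivlMr// div1r; lra.
  have den : 0 < (1 + p) * (h * t - 1) by rewrite mulr_gt0//; lra.
  split; last exact: full.
  + move=> /andP[th0 thle]; apply: pieces; [exact: ltW| |by rewrite th0].
    (* The threshold lies strictly below p / t because t > p + 1. *)
    apply: le_lt_trans thle _; rewrite ltr_pdivrMr//.
    rewrite mulrC mulrAC -mulrA ltr_pM2l// ltr_pdivlMr; last by lra.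
    have -> : (1 + p) * (h * t - 1) = (h + h * p - 1) * t + (t - p - 1) by ring.
    by lra.
  + move=> /andP[]; rewrite ltr_pdivrMr// => thlt thp.
    have th0 : 0 < theta.
      have : 0 < theta * ((1 + p) * (h * t - 1)) by apply: lt_trans thlt; rewrite mulr_gt0.
      by rewrite pmulr_lgt0.
    apply: middle; [by rewrite th0| |exact: ltW].
    (* Multiplied by [p], the claim follows from the lower bound on [theta] and
       [h * t - 1 < h * p]. *)
    rewrite -subr_ge0 -(pmulr_rge0 _ p_gt0).
    have : theta * ((1 + p) * (h * t - 1)) <= theta * ((1 + p) * (h * p)).
      by rewrite ler_wpM2l ?(ltW th0)// ler_wpM2l//; lra.
    by lra.
- move=> pht theta.
  have htp : 1 <= h * (t - p) by rewrite mulrC -ler_pdivrMr// div1r; lra.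
  have hp0 : 0 < h * (1 + p) by rewrite mulr_gt0//; lra.
  split; last exact: full.
  + exact: (assouad_spectrum_dim p_gt0 t_ge h_range c_bounds S_affine c_tail' F_dim htp).
  + move=> /andP[]; rewrite ltr_pdivrMr// => thlt thp.
    have th0 : 0 < theta.
      have : 0 < theta * (h * (1 + p)) by apply: lt_trans thlt.
      by rewrite pmulr_lgt0.
    apply: middle; [by rewrite th0| by lra|].
    (* Here [h * p <= h * t - 1], so the lower bound on [theta] also puts the count of whole pieces
       below that of points. *)
    have : theta * ((1 + p) * (h * p)) <= theta * ((1 + p) * (h * t - 1)).
      by rewrite ler_wpM2l ?(ltW th0)// ler_wpM2l//; lra.
    by have := ltr_pM2r p_gt0 (h + h * p - 1) (theta * (h * (1 + p))); rewrite thlt; lra.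
Qed.
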